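(* For all positive integers $m$ and $p$, $$(-1)^m \sum_{j=1}^p W(2j+2m-3,2m-1)\,Z(j,p)=(-1)^p \sum_{j=1}^m W(2j+2p-3,2p-1)\,Z(j,m).$$
   Context: For positive integers $k_1,\dots,k_r$ the alternating multiple $T$-value is $\bar T(k_1,\ldots,k_r):=2^r\sum_{0<n_1<\cdots<n_r}\frac{(-1)^{n_r}}{(2n_1-1)^{k_1}(2n_2-2)^{k_2}\cdots(2n_r-r)^{k_r}}$ (conditionally convergent series), with $\bar T(\emptyset):=1$. $I(k,r)$ denotes the set of tuples $(k_1,\dots,k_r)$ of positive integers with $k_1+\cdots+k_r=k$. $W(k,r):=\sum_{(k_1,\dots,k_r)\in I(k,r)}\bar T(k_1,\dots,k_r)$. $\bar\zeta(s):=\sum_{n\ge1}(-1)^{n-1}n^{-s}$ for integers $s\ge1$, and $\bar\zeta(0):=1/2$. For integers $1\le j\le p$: $Z(p,p):=1$ and, for $j<p$, $Z(j,p):=\sum_{k=1}^{p-j}(-2)^k\sum_{j=i_0<i_1<\cdots<i_{k-1}<i_k=p}\ \prod_{l=1}^k\bar\zeta(2i_l-2i_{l-1})$. *)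

(* Defs.v *)
From HB Require Import structures.
From mathcomp Require Import all_boot all_order all_algebra.
From mathcomp Require Import all_classical all_reals all_analysis.
Set Implicit Arguments. Unset Strict Implicit. Unset Printing Implicit Defensive.
Import Order.TTheory GRing.Theory Num.Theory.
Import numFieldNormedType.Exports.
Local Open Scope ring_scope.

Section Defs.
Variable R : realType.

(* Inner (finite) part of the alternating multiple T-value, for fixed largest
   index n_r = n, with r = size ks >= 1:
   sum over 0 < n_1 < ... < n_{r-1} < n of
   prod_{i=1}^r 1 / (2 n_i - i)^{k_i}. *)
Definition Tbar_inner (ks : seq nat) (n : nat) : R :=
  \sum_(t : (size ks).-1.-tuple 'I_n | sorted ltn (0%N :: map val t))
    let ns := rcons (map val t) n in
    \prod_(i < size ks)
      ((2 * (nth 0%N ns i)%:R - (i.+1)%:R) ^+ (nth 0%N ks i))^-1.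

Definition Tbar_partial (ks : seq nat) (N : nat) : R :=
  \sum_(1 <= n < N.+1) (-1) ^+ n * Tbar_inner ks n.

(* Alternating multiple T-value (conditionally convergent series, summed as the
   limit of partial sums truncated on the largest index n_r); Tbar [::] = 1. *)
Definition Tbar (ks : seq nat) : R :=
  if ks is [::] then 1
  else 2 ^+ size ks * limn (Tbar_partial ks).

Definition W (k r : nat) : R :=
  \sum_(t : r.-tuple 'I_k.+1 | all (fun x => 0 < x)%N (map val t)
                                && (sumn (map val t) == k))
    Tbar (map val t).

Definition zetabar (s : nat) : R :=
  if s is 0%N then 2^-1
  else limn (fun N : nat => \sum_(1 <= n < N.+1) (-1) ^+ n.-1 / (n%:R ^+ s) : R).

Definition Z (j p : nat) : R :=
  if j == p then 1
  else \sum_(1 <= k < (p - j).+1)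
         (-2) ^+ k *
         \sum_(t : k.-tuple 'I_p.+1 | sorted ltn (j :: map val t)
                                      && (last j (map val t) == p))
           let s := j :: map val t in
           \prod_(l < k) zetabar (2 * nth 0%N s l.+1 - 2 * nth 0%N s l)%N.

End Defs.

(* Main.v *)
Require Import Defs.
From HB Require Import structures.
From mathcomp Require Import all_boot all_order all_algebra.
From mathcomp Require Import all_classical all_reals all_analysis.
From mathcomp Require Import complex ring lra zify.
Import Order.TTheory GRing.Theory Num.Theory.
Import numFieldNormedType.Exports.
Local Open Scope ring_scope.

Set Implicit Arguments.
Unset Strict Implicit.
Unset Printing Implicit Defensive.

(** Let A(x,y;t) be the generating series of 2^r sum t^(a_r) prod 1/(a_i - x)
    over chains a_1 < ... < a_r of alternating parity with a_1 odd, y marking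
    the depth r; its coefficients at t = i are the sums W(k,r) up to a power
    of i.  With U = log t and V = log((1+t)/(1-t)) it satisfies
    dA = (x dU + y dV) A - x dU.  The involution s = (1-t)/(1+t) exchanges U
    and -V, hence e^(-xU-yV) (A(x,y;t) + A(-y,-x;s) - 1) is constant.  On the
    circle |t+1|^2 = 2, which joins a real point to i, one has s = conj t, so
    this constant is real.  At t = i the reality yields, with c = cos(pi x/2),
    s = sin(pi x/2)/x and c', s' the same in y, two linear relations between
    the odd-depth part M(x^2,y^2), its transpose and an even-depth series;
    eliminating the latter gives s c M = s' c' M^T.  Finally 2 s c is pi times
    the series sin(pi x)/(pi x), whose coefficients are the Z(j,p) by Euler's
    partial fraction expansion of pi x/sin(pi x).

    Everything is carried out on truncated sums: the truncated constant has
    derivative O(sqrt N |t|^(2N)) along the circle, which integrates to o(1). *)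

(** * Chains and compositions *)

(** Truncation is forced by the endpoint: the full series can be differentiated termwise for |t| <
    1, but at t = i the sums W converge only conditionally. A truncated sum is a polynomial in t,
    and its differential equation fails only by the boundary term of a summation by parts. The bound
    on that term does not tend to 0 at i itself, where |t| = 1; only its integral does, because |t|
    increases at positive logarithmic speed near i and so |t|^(2N) has integral O(1/N). A growth
    bound N^e with e < 1 for the unsigned sums would do; e = 1/2 reproduces itself from depth to
    depth, so no powers of logarithms need tracking. As s = conj t on the path and all coefficients
    are real, the value at s is a complex conjugate, and only the series at t is ever formed. The
    variables x and y stay formal: statements concern the coefficient of x^a y^b, with a the weight
    minus the depth and b the depth. The expansion of pi x/sin(pi x) enters only as an identity
    between coefficients, obtained by integrating even powers against the Dirichlet kernel on
    [0, pi]. *)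

Lemma sum_tuple_seq (V : nmodType) (r n : nat) (P : pred (seq nat))
    (l : seq (seq nat)) (F : seq nat -> V) :
  uniq l ->
  (forall s, (s \in l) = [&& size s == r, all (fun x => (x < n)%N) s & P s]) ->
  \sum_(t : r.-tuple 'I_n | P (map val t)) F (map val t) = \sum_(s <- l) F s.
Proof.
move=> ul ml.
rewrite -(big_map (fun t : r.-tuple 'I_n => map val t) P F).
rewrite -big_filter; apply: perm_big; apply: uniq_perm => //.
  rewrite filter_uniq // map_inj_uniq ?index_enum_uniq // => t1 t2 e.
  by apply: val_inj => /=; exact: (inj_map val_inj e).
move=> s; rewrite mem_filter ml; apply/andP/and3P.
  case=> Ps /mapP[t _ e]; split=> //; first by rewrite e size_map size_tuple.
  by rewrite e all_map; apply/allP => i _ /=.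
case=> /eqP ss sn Ps; split=> //; apply/mapP.
have e : map val (pmap insub s : seq 'I_n) = s.
  elim: s sn {Ps ss} => //= x s IH /andP[xn /IH sn].
  by rewrite insubT /= sn.
have sz : size (pmap insub s : seq 'I_n) == r by rewrite -ss -[in X in _ == X]e size_map.
by exists (Tuple sz); rewrite ?mem_index_enum //= e.
Qed.

Lemma uniq_rcons_dep (J : seq nat) (g : nat -> nat) (L : nat -> seq (seq nat)) :
  uniq J -> injective g -> (forall j, uniq (L j)) ->
  uniq [seq rcons s (g j) | j <- J, s <- L j].
Proof.
move=> uJ gi uL; apply: allpairs_uniq_dep => // -[j s] [j' s'] _ _ /= /eqP.
by rewrite eqseq_rcons => /andP[/eqP-> /eqP/gi->].
Qed.

Lemma uniq_cons_dep (J : seq nat) (L : nat -> seq (seq nat)) :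
  uniq J -> (forall j, uniq (L j)) -> uniq [seq j :: s | j <- J, s <- L j].
Proof.
move=> uJ uL; apply: allpairs_uniq_dep => // -[j s] [j' s'] _ _ /= [-> ->] //.
Qed.

Fixpoint chains (b n : nat) : seq (seq nat) :=
  if b is b'.+1 then [seq rcons s m | m <- iota 1 n.-1, s <- chains b' m]
  else [:: [::]].

Lemma chains_uniq b n : uniq (chains b n).
Proof.
elim: b n => //= b IH n.
by apply: (@uniq_rcons_dep _ id) => //; exact: iota_uniq.
Qed.

Lemma mem_chains b n s : (s \in chains b n) =
  [&& size s == b, all (fun x => (x < n)%N) s & sorted ltn (0%N :: s)].
Proof.
elim: b n s => [|b IH] n s /=.
  rewrite inE; case: s => //.
apply/allpairsPdep/and3P => [[m [s' [mi]]]|].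
  rewrite IH => /and3P[/eqP ss sm ps] ->.
  rewrite mem_iota in mi; split; first by rewrite size_rcons ss.
    rewrite all_rcons; apply/andP; split; first by lia.
    by apply: sub_all sm => x; lia.
  move: ps; rewrite /= rcons_path => -> /=.
  case/lastP: s' sm {ss} => [|s' x] /=; first by lia.
  by rewrite last_rcons all_rcons => /andP[].
case/lastP: s => [[]//|s m]; rewrite size_rcons eqSS all_rcons rcons_path.
move=> [ss /andP[mn sn] /andP[ps lm]]; exists m, s; split=> //.
  by rewrite mem_iota; lia.
rewrite IH ss /= ps andbT.
have : sorted ltn (rcons (0%N :: s) m) by rewrite /= rcons_path ps.
by rewrite (sorted_pairwise ltn_trans) pairwise_rcons => /andP[/= /andP[]].
Qed.

(** The argument [a] is the excess of weight over depth: these are the compositions of a + r into r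
    positive parts. The excess is the exponent of x in the generating series. *)
Fixpoint compositions (a r : nat) : seq (seq nat) :=
  if r is r'.+1 then
    [seq rcons s j.+1 | j <- iota 0 a.+1, s <- compositions (a - j) r']
  else if a is 0%N then [:: [::]] else [::].

Lemma compositions_uniq a r : uniq (compositions a r).
Proof.
elim: r a => [[]//|r IH a] /=.
apply: (@uniq_rcons_dep (0%N :: iota 1 a) S) => //.
- exact: (iota_uniq 0 a.+1).
- exact: succn_inj.
Qed.

Lemma mem_compositions a r s : (s \in compositions a r) =
  [&& size s == r, all (fun x => (x < (a + r).+1)%N) s &
      all (fun x => 0 < x)%N s && (sumn s == (a + r)%N)].
Proof.
elim: r a s => [a s|r IH a s].
  rewrite addn0; case: a => [|a] /=; first by rewrite inE; case: s.
  by case: s.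
apply/allpairsPdep/and3P => [[j [s' [ji]]]|].
  rewrite IH => /and3P[/eqP ss sm /andP[ps /eqP se]] ->.
  rewrite mem_iota in ji; split; first by rewrite size_rcons ss.
    rewrite all_rcons; apply/andP; split; first by lia.
    by apply: sub_all sm => x; lia.
  rewrite all_rcons ps -cats1 sumn_cat se /=; apply/eqP; lia.
case/lastP: s => [[]//|s m].
rewrite size_rcons eqSS !all_rcons -cats1 sumn_cat /=.
move=> [ss /andP[mn sn] /andP[/andP[m0 ps] /eqP se]].
have ge : (size s <= sumn s)%N.
  elim: s ps {ss sn se} => //= x s IHs /andP[x0 /IHs]; lia.
move/eqP in ss; have {}ge : (r <= sumn s)%N by rewrite -ss.
exists m.-1, s; split => //.
- by rewrite (mem_iota 0 a.+1); lia.
- rewrite IH ss eqxx ps /=; apply/andP; split; last by apply/eqP; lia.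
  apply/allP => x xs; have : (x <= sumn s)%N.
    elim: s xs {ss sn se ps ge} => //= y s IHs.
    by rewrite inE => /orP[/eqP->|/IHs]; lia.
  lia.
- by rewrite cats1 prednK.
Qed.

(** * Nested sums *)

Section Inner.
Variable R : realType.

(** The exponents are listed from the largest index downwards, so that one recursion step peels off
    the outermost summation. The base case is a unit mass at 0, standing for n_0 = 0. *)
Fixpoint nested_sum (rks : seq nat) (n : nat) : R :=
  if rks is k :: rks' then
    ((2 * n%:R - (size rks').+1%:R) ^+ k)^-1 * \sum_(m < n) nested_sum rks' m
  else (n == 0%N)%:R.

Lemma Tbar_inner_nested_sum ks n : (0 < size ks)%N -> (0 < n)%N ->
  Tbar_inner R ks n = nested_sum (rev ks) n.
Proof.
move=> ks0 n0; rewrite /Tbar_inner.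
rewrite (@sum_tuple_seq _ _ _ (fun s => sorted ltn (0%N :: s))
  (chains (size ks).-1 n)
  (fun s => \prod_(i < size ks)
    ((2 * (nth 0%N (rcons s n) i)%:R - i.+1%:R) ^+ nth 0%N ks i)^-1)
  (chains_uniq _ _)); last by move=> s; rewrite mem_chains.
case/lastP: ks ks0 => // ks k _; rewrite size_rcons /= rev_rcons /=.
elim/last_ind: ks k n n0 => [|ks k' IH] k n n0.
  rewrite /= big_seq1 big_ord1 /=.
  case: n n0 => // n _; rewrite big_ord_recl big1 ?addr0 /= ?mulr1 //.
rewrite size_rcons /= rev_rcons big_allpairs_dep /=.
transitivity (\sum_(m <- iota 1 n.-1)
   ((2 * n%:R - (size ks).+2%:R) ^+ k)^-1 * nested_sum (k' :: rev ks) m : R).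
  apply: eq_big_seq => m; rewrite mem_iota => mi.
  rewrite [nested_sum (k' :: _) m]/= -(IH k'); last by lia.
  rewrite mulr_sumr; apply: eq_big_seq => s; rewrite mem_chains => /and3P[/eqP ss _ _].
  rewrite big_ord_recr /= mulrC; congr (_ * _).
    by rewrite !nth_rcons !size_rcons ss !ltnn !eqxx.
  apply: eq_bigr => i _; have i1 := ltn_ord i.
  by rewrite !(nth_rcons _ (rcons _ _)) !size_rcons ss i1.
rewrite -mulr_sumr ?size_rcons size_rev; congr (_ * _).
case: n n0 => // n _; rewrite big_ord_recl big_ord0 mulr0 add0r.
rewrite (iotaDl 1 0) big_map -[n in iota 0 n]subn0 big_mkord.
by apply: eq_bigr => i _; rewrite /= size_rev.
Qed.

(** Increasing positive indices force n_r >= r. Hence denominators 2n - r matter only where they are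
    at least n, and a zero denominator occurs only over an empty sum. *)
Lemma nested_sum_small rks n : (n < size rks)%N -> nested_sum rks n = 0.
Proof.
elim: rks n => // k rks IH n /= nk; rewrite big1 ?mulr0 // => i _.
by rewrite IH //; have := ltn_ord i; lia.
Qed.

Lemma denom_ge (n r : nat) : (r <= n)%N -> n%:R <= 2 * n%:R - r%:R :> R.
Proof. by rewrite -(ler_nat R) => ?; lra. Qed.

Lemma nested_sum_ge0 rks n : 0 <= nested_sum rks n.
Proof.
elim: rks n => [n|k rks IH n]; first by rewrite /=.
have [nk|kn] := ltnP n (size (k :: rks)); first by rewrite nested_sum_small.
rewrite /= mulr_ge0 ?sumr_ge0 // invr_ge0 exprn_ge0 //.
by apply: le_trans (denom_ge kn).
Qed.

Lemma inv_sqrt_le (n : nat) :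
  (Num.sqrt n.+1%:R)^-1 <= 2 * (Num.sqrt n.+1%:R - Num.sqrt n%:R) :> R.
Proof.
have x0 : 0 < Num.sqrt n.+1%:R :> R by rewrite sqrtr_gt0 ltr0n.
have xx : Num.sqrt n.+1%:R ^+ 2 = n.+1%:R :> R by rewrite sqr_sqrtr // ler0n.
have yy : Num.sqrt n%:R ^+ 2 = n%:R :> R by rewrite sqr_sqrtr // ler0n.
rewrite -[leLHS]mul1r ler_pdivrMr //.
move: xx yy; rewrite -natr1; set x := Num.sqrt _; set y := Num.sqrt _ => xx yy.
rewrite (_ : 2 * (x - y) * x = (x ^+ 2 - y ^+ 2) + (x - y) ^+ 2); last by ring.
by rewrite xx yy (addrC _ 1) addrK lerDl sqr_ge0.
Qed.

(** The two bounds feed each other along the depth: inner sums at most C sqrt n over a denominator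
    at least n give terms at most C / sqrt n, and these add up to 2 C sqrt n by telescoping. *)
Lemma nested_sum_bound rks : all (fun k => 0 < k)%N rks ->
  exists2 C : R, 0 <= C &
    (forall n, \sum_(m < n) nested_sum rks m <= C * Num.sqrt n%:R) /\
    (forall n, nested_sum rks n.+1 <= C / Num.sqrt n.+1%:R).
Proof.
elim: rks => [_|k rks IH /andP[k0 /IH[C C0 [SC _]]]].
  exists 1 => //; split=> [[|n]|n].
  - by rewrite big_ord0 sqrtr0 mulr0.
  - rewrite big_ord_recl big1 //= addr0 mul1r -[leLHS]sqrtr1.
    by rewrite ler_sqrt ?ler1n // ler0n.
  - by rewrite /= divr_ge0 ?sqrtr_ge0.
have H n : nested_sum (k :: rks) n.+1 <= C / Num.sqrt n.+1%:R.
  have [nk|kn] := ltnP n.+1 (size (k :: rks)).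
    by rewrite nested_sum_small // divr_ge0 ?sqrtr_ge0.
  have x0 : 0 < Num.sqrt n.+1%:R :> R by rewrite sqrtr_gt0 ltr0n.
  have -> : C / Num.sqrt n.+1%:R = n.+1%:R^-1 * (C * Num.sqrt n.+1%:R).
    rewrite -[in n.+1%:R^-1](@sqr_sqrtr _ n.+1%:R) ?ler0n // expr2.
    by field; rewrite gt_eqF.
  apply: ler_pM; rewrite ?invr_ge0 ?exprn_ge0 ?sumr_ge0 //.
  - by apply: le_trans (denom_ge kn).
  - by move=> i _; exact: nested_sum_ge0.
  - have d1 : 1 <= 2 * n.+1%:R - (size rks).+1%:R :> R.
      by apply: le_trans (denom_ge kn); rewrite ler1n.
    rewrite lef_pV2 ?posrE ?ltr0n ?exprn_gt0 //; last exact: lt_le_trans d1.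
    apply: le_trans (denom_ge kn) _.
    by rewrite -(prednK k0) exprS ler_peMr ?exprn_ege1 // (le_trans ler01 d1).
have G n : \sum_(m < n.+1) nested_sum (k :: rks) m <= 2 * C * Num.sqrt n%:R.
  elim: n => [|n IHn].
    by rewrite big_ord1 nested_sum_small // sqrtr0 mulr0.
  rewrite big_ord_recr.
  have h := le_trans (H n) (ler_wpM2l C0 (inv_sqrt_le n)).
  apply: le_trans (lerD IHn h) _; rewrite le_eqVlt; apply/orP; left.
  by apply/eqP; ring.
exists (2 * C); first by rewrite mulr_ge0.
split=> n; last by apply: le_trans (H n) _; rewrite ler_wpM2r ?invr_ge0 ?sqrtr_ge0 //; lra.
by apply: le_trans (G n); rewrite big_ord_recr lerDl; exact: nested_sum_ge0.
Qed.

End Inner.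

(** * Convergence of the alternating sums *)

Section Convergence.
Variable R : realType.
Local Open Scope classical_set_scope.

Lemma cvg_inv_sqrt : (Num.sqrt n.+1%:R)^-1 @[n --> \oo] --> (0 : R).
Proof.
have h : Num.sqrt \o harmonic @ \oo --> Num.sqrt (0 : R).
  by apply: continuous_cvg; [exact: sqrt_continuous|exact: cvg_harmonic].
rewrite sqrtr0 in h; rewrite (_ : (fun n => _) = Num.sqrt \o harmonic) //.
by apply: funext => n; rewrite /= sqrtrV // ler0n.
Qed.

(** Bounded variation replaces monotonicity in the alternating series test: averaging the sum with
    its shift leaves a series of differences, which converges absolutely, and a null boundary
    term. *)
Lemma alternating_cvg (u B : nat -> R) (M : R) :
  (forall n, `|u n.+1 - u n| <= B n) -> (forall N, \sum_(n < N) B n <= M) ->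
  u n @[n --> \oo] --> 0 -> cvgn (fun N => \sum_(n < N) (-1) ^+ n * u n).
Proof.
move=> uB BM u0.
pose d n := (-1) ^+ n * (u n - u n.+1).
have cd : cvgn (series d).
  apply: normed_cvg; apply: nondecreasing_is_cvgn.
    by apply: nondecreasing_series => n _ _; exact: normr_ge0.
  exists M => _ [N _ <-]; apply: le_trans (BM N); rewrite /normed_series_of /series /= big_mkord.
  apply: ler_sum => n _; rewrite /d normrM normrX normrN normr1 expr1n mul1r.
  by rewrite distrC.
have E N : \sum_(n < N) (-1) ^+ n * u n =
    2^-1 * (series d N + u 0%N - (-1) ^+ N * u N).
  rewrite /series /= big_mkord; elim: N => [|N IH].
    by rewrite !big_ord0 expr0; ring.
  by rewrite !big_ord_recr /= IH /d exprS; field.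
have s0 : (-1) ^+ N * u N @[N --> \oo] --> 0.
  apply/cvgr0Pnorm_lt => e e0.
  near=> N; rewrite normrM normrX normrN normr1 expr1n mul1r.
  by near: N; move/cvgr0Pnorm_lt : u0; exact.
rewrite (funext E); apply: is_cvgMl_tmp; apply: is_cvgB; last by apply/cvg_ex; exists 0.
by apply: is_cvgD => //; exact: is_cvg_cst.
Unshelve. all: by end_near. Qed.

Lemma nested_sum_alternating_cvg (k : nat) rks : all (fun x => 0 < x)%N (k :: rks) ->
  cvgn (fun N => \sum_(n < N) (-1) ^+ n * nested_sum R (k :: rks) n).
Proof.
move=> kpos; have [C C0 [_ HC]] := nested_sum_bound R kpos.
have /andP[k0 /(nested_sum_bound R)[C' C'0 [_ HC']]] := kpos.
(* Shifting by the depth skips the vanishing terms and makes all denominators at least 1. The factor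
   [v] then decreases while the inner sum [S] increases, so [u] need not be monotone, but its upward
   variation is controlled by the increments of [S]. *)
set r := size (k :: rks); pose u n := nested_sum R (k :: rks) (n + r).
have r0 : (0 < r)%N by [].
pose v n : R := ((2 * (n + r)%:R - r%:R) ^+ k)^-1.
pose S n : R := \sum_(m < n + r) nested_sum R rks m.
have uE n : u n = v n * S n by [].
have SS n : S n.+1 = S n + nested_sum R rks (n + r) by rewrite /S addSn big_ord_recr.
have S_ge0 n : 0 <= S n by apply: sumr_ge0 => i _; exact: nested_sum_ge0.
have d_gt0 n : 1 <= 2 * (n + r)%:R - r%:R :> R.
  apply: (@le_trans _ _ (n + r)%:R); first by rewrite ler1n addn_gt0 r0 orbT.
  by apply: denom_ge; rewrite leq_addl.
have v_decr n : v n.+1 <= v n.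
  rewrite lef_pV2 ?posrE ?exprn_gt0 //; last 2 first.
  - exact: lt_le_trans (d_gt0 _).
  - exact: lt_le_trans (d_gt0 _).
  rewrite lerXn2r ?nnegrE ?(le_trans ler01) //.
  by rewrite addSn -natr1; lra.
have v_le n : v n.+1 <= (n + r).+1%:R^-1.
  rewrite lef_pV2 ?posrE ?ltr0n ?exprn_gt0 ?(lt_le_trans ltr01) //.
  have h := d_gt0 n.+1; apply: (@le_trans _ _ (2 * (n.+1 + r)%:R - r%:R)).
    by rewrite addSn; apply: denom_ge; lia.
  by rewrite -(prednK k0) exprS ler_peMr ?exprn_ege1 // (le_trans ler01 h).
have g_le n : v n.+1 * nested_sum R rks (n + r) <=
    2 * C' * ((Num.sqrt (n + r)%:R)^-1 - (Num.sqrt (n + r).+1%:R)^-1).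
  apply: (@le_trans _ _ ((n + r).+1%:R^-1 * (C' / Num.sqrt (n + r)%:R))).
    apply: ler_pM => //; rewrite ?nested_sum_ge0 //.
      by rewrite invr_ge0 exprn_ge0 // (le_trans ler01).
    by rewrite -(prednK r0) addnS; exact: HC'.
  rewrite -(prednK r0) addnS; move: (n + r.-1)%N => m.
  have x0 : 0 < Num.sqrt m.+1%:R :> R by rewrite sqrtr_gt0 ltr0n.
  have y0 : 0 < Num.sqrt m.+2%:R :> R by rewrite sqrtr_gt0 ltr0n.
  have h := inv_sqrt_le R m.+1.
  have yy : Num.sqrt m.+2%:R ^+ 2 = m.+2%:R :> R by rewrite sqr_sqrtr // ler0n.
  rewrite -[X in X^-1 * _]yy; move: h x0 y0 {yy}; set x := Num.sqrt m.+1%:R; set y := Num.sqrt m.+2%:R.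
  move=> h x0 y0.
  have -> : (y ^+ 2)^-1 * (C' / x) = C' / (x * y) * y^-1.
    by field; rewrite !gt_eqF.
  have -> : 2 * C' * (x^-1 - y^-1) = C' / (x * y) * (2 * (y - x)).
    by field; rewrite !gt_eqF.
  by rewrite ler_wpM2l // divr_ge0 // mulr_ge0 ?ltW.
(* The increase of [u] is at most the quantity bounded in [g_le], so the absolute increment is at
   most twice that quantity minus the increment. Both parts of [B] telescope. *)
pose B n := 4 * C' * ((Num.sqrt (n + r)%:R)^-1 - (Num.sqrt (n + r).+1%:R)^-1) + (u n - u n.+1).
have cu : cvgn (fun N => \sum_(n < N) (-1) ^+ n * u n).
  apply: (@alternating_cvg _ B (4 * C' + u 0%N)).
  - move=> n; rewrite /B; have := g_le n; have := v_decr n; have := S_ge0 n.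
    have vg : 0 <= v n.+1 * nested_sum R rks (n + r).
      by rewrite mulr_ge0 ?nested_sum_ge0 // invr_ge0 exprn_ge0 // (le_trans ler01).
    move=> s0 vd gl; have := mulr_ge0 (_ : 0 <= v n - v n.+1) s0.
    rewrite subr_ge0 => /(_ vd) vS.
    rewrite !uE SS ler_norml; apply/andP; split; nra.
  - move=> N; suff -> : \sum_(n < N) B n = 4 * C' * ((Num.sqrt r%:R)^-1 - (Num.sqrt (N + r)%:R)^-1) + (u 0%N - u N).
      have uN : 0 <= u N by exact: nested_sum_ge0.
      have i0 : 0 <= (Num.sqrt (N + r)%:R)^-1 :> R by rewrite invr_ge0 sqrtr_ge0.
      have i1 : (Num.sqrt r%:R)^-1 <= 1 :> R.
        rewrite invf_le1 ?sqrtr_gt0 ?ltr0n // -[leLHS]sqrtr1.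
        by rewrite ler_sqrt ?ler1n ?ler0n ?ltr0n.
      have : 4 * C' * ((Num.sqrt r%:R)^-1 - (Num.sqrt (N + r)%:R)^-1) <= 4 * C' * 1.
        by rewrite ler_wpM2l ?mulr_ge0 //; lra.
      by lra.
    elim: N => [|N IH]; first by rewrite big_ord0 add0n; ring.
    by rewrite big_ord_recr /= IH /B addSn; ring.
  - apply: (@squeeze_cvgr _ _ _ _ (fun=> 0) (fun n => C * (Num.sqrt n.+1%:R)^-1)).
    + near=> n; rewrite nested_sum_ge0 /=.
      apply: (@le_trans _ _ (C / Num.sqrt (n + r)%:R)).
        by rewrite /u -(prednK r0) addnS; exact: HC.
      rewrite ler_wpM2l // lef_pV2 ?posrE ?sqrtr_gt0 ?ltr0n ?addn_gt0 ?r0 ?orbT //.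
      by rewrite ler_sqrt ?ler0n // ler_nat; lia.
    + exact: cvg_cst.
    + by rewrite -[X in _ --> X](mulr0 C); apply: cvgMl_tmp; exact: cvg_inv_sqrt.
apply/cvg_ex; exists (0 + (-1) ^+ r * limn (fun N => \sum_(n < N) (-1) ^+ n * u n)).
rewrite -(cvg_shiftn r).
rewrite (_ : [sequence _]_n = fun n => 0 + (-1) ^+ r * \sum_(i < n) (-1) ^+ i * u i).
  by apply: cvgD; [exact: cvg_cst|apply: cvgMl_tmp].
apply: funext => n.
rewrite [LHS](_ : _ = \sum_(i < n + r) (-1) ^+ i * nested_sum R (k :: rks) i) //.
rewrite addnC big_split_ord; congr (_ + _).
  rewrite big1 // => i _; rewrite nested_sum_small ?mulr0 //; exact: (ltn_ord i).
rewrite mulr_sumr; apply: eq_bigr => i _.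
by rewrite mulrA -exprD /u (addnC i).
Unshelve. all: by end_near. Qed.

End Convergence.

(** * Sums over all exponents of given weight and depth *)

Section WeightSum.
Variable R : realType.
Local Open Scope classical_set_scope.

Definition weight_sum (a b n : nat) : R :=
  \sum_(s <- compositions a b) nested_sum R (rev s) n.

Lemma size_compositions a b s : s \in compositions a b -> size s = b.
Proof. by rewrite mem_compositions => /and3P[/eqP]. Qed.

Lemma weight_sum0 a n : weight_sum a 0 n = ((a == 0) && (n == 0))%:R.
Proof. by rewrite /weight_sum; case: a => [|a]; rewrite ?big_seq1 ?big_nil. Qed.

Lemma weight_sum_small a b n : (n < b)%N -> weight_sum a b n = 0.
Proof.
move=> nb; apply: big1_seq => s /= /size_compositions sb.
by rewrite nested_sum_small // size_rev sb.
Qed.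

Lemma weight_sumS a b n : weight_sum a b.+1 n =
  \sum_(j < a.+1) ((2 * n%:R - b.+1%:R) ^+ j.+1)^-1 *
    \sum_(m < n) weight_sum (a - j) b m.
Proof.
rewrite /weight_sum -(big_mkord xpredT (fun j => ((2 * n%:R - b.+1%:R) ^+ j.+1)^-1 *
    \sum_(m < n) \sum_(s <- compositions (a - j) b) nested_sum R (rev s) m)).
rewrite [LHS]big_allpairs_dep /index_iota subn0; apply: eq_bigr => j _.
rewrite exchange_big mulr_sumr; apply: eq_big_seq => s /size_compositions sb.
by rewrite rev_rcons /= size_rev sb.
Qed.

Lemma denom_eq0 (n b : nat) : (2 * n%:R - b.+1%:R == 0 :> R) -> (n <= b)%N.
Proof. by rewrite subr_eq0 -natrM eqr_nat; lia. Qed.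

Lemma weight_sum_step0 b n :
  (2 * n%:R - b.+1%:R) * weight_sum 0 b.+1 n = \sum_(m < n) weight_sum 0 b m.
Proof.
rewrite weight_sumS big_ord1 expr1 subn0.
(* A zero denominator has inverse 0; the identity survives because then n <= b, where the inner sums
   vanish. *)
have [x0|x0] := eqVneq (2 * n%:R - b.+1%:R : R) 0; last by rewrite mulVKf.
rewrite x0 mul0r big1 // => i _; rewrite weight_sum_small //.
by move/eqP/denom_eq0: x0; apply: leq_trans.
Qed.

(** Multiplication by the exponent 2n - (b+1) of t is the operator t d/dt. It lowers the outermost
    exponent by one, which is the x dU term, or removes the outermost factor when that exponent is
    1, which is the y dV term. *)
Lemma weight_sum_stepS a b n : (2 * n%:R - b.+1%:R) * weight_sum a.+1 b.+1 n =
  weight_sum a b.+1 n + \sum_(m < n) weight_sum a.+1 b m.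
Proof.
have [x0|x0] := eqVneq (2 * n%:R - b.+1%:R : R) 0.
  have nb : (n <= b)%N by move/eqP/denom_eq0: x0.
  rewrite x0 mul0r weight_sum_small // big1 ?addr0 // => i _.
  by rewrite weight_sum_small // (leq_trans _ nb).
rewrite !weight_sumS big_ord_recl mulrDr addrC; congr (_ + _).
  rewrite mulr_sumr; apply: eq_bigr => j _; rewrite subSS.
  by rewrite lift0 exprS invfM mulrA mulrA mulfV // mul1r.
by rewrite subn0 expr1 mulVKf.
Qed.

Lemma weight_sum_bound a b : exists2 C : R, 0 <= C &
  forall n, 0 <= \sum_(m < n) weight_sum a b m <= C * Num.sqrt n%:R.
Proof.
suff [C C0 H] : exists2 C : R, 0 <= C & forall n,
    \sum_(m < n) weight_sum a b m <= C * Num.sqrt n%:R.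
  exists C => // n; rewrite H andbT !sumr_ge0 // => i _.
  by rewrite sumr_ge0 // => s _; exact: nested_sum_ge0.
have : {in compositions a b, forall s, all (fun x => 0 < x)%N (rev s)}.
  by move=> s; rewrite mem_compositions all_rev => /and3P[_ _ /andP[]].
rewrite /weight_sum; elim: (compositions a b) => [_|s l IH].
  by exists 0 => // n; rewrite big1 ?mul0r // => i _; rewrite big_nil.
move=> Hs; have [|C C0 HC] := IH; first by move=> t tl; apply: Hs; rewrite inE tl orbT.
have [C' C'0 [HC' _]] := nested_sum_bound R (Hs s (mem_head _ _)).
exists (C' + C); first by rewrite addr_ge0.
move=> n; rewrite mulrDl (eq_bigr _ (fun i _ => big_cons _ _ _ _ _ _)) /=.
by rewrite big_split; exact: (lerD (HC' n) (HC n)).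
Qed.

Lemma cvg_sum_seq (T : eqType) (l : seq T) (f : T -> nat -> R) (g : T -> R) :
  (forall s, s \in l -> f s n @[n --> \oo] --> g s) ->
  \sum_(s <- l) f s n @[n --> \oo] --> \sum_(s <- l) g s.
Proof.
elim: l => [_|s l IH H].
  rewrite big_nil (_ : (fun _ => _) = fun=> 0); first exact: cvg_cst.
  by apply: funext => n; rewrite big_nil.
rewrite big_cons (_ : (fun _ => _) = fun n => f s n + \sum_(s <- l) f s n).
  apply: cvgD; first by apply: H; exact: mem_head.
  by apply: IH => t tl; apply: H; rewrite inE tl orbT.
by apply: funext => n; rewrite big_cons.
Qed.

Lemma Tbar_cvg (s : seq nat) : (0 < size s)%N -> all (fun x => 0 < x)%N s ->
  2 ^+ size s * \sum_(n < N.+1) (-1) ^+ n * nested_sum R (rev s) n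
    @[N --> \oo] --> Tbar R s.
Proof.
move=> s0 sp.
have -> : Tbar R s = 2 ^+ size s * limn (Tbar_partial R s) by case: s s0 {sp}.
have E : (fun N => \sum_(n < N.+1) (-1) ^+ n * nested_sum R (rev s) n) = Tbar_partial R s.
  apply: funext => N; rewrite /Tbar_partial big_ord_recl nested_sum_small ?size_rev //.
  rewrite mulr0 add0r big_add1 big_mkord; apply: eq_bigr => i _.
  by rewrite Tbar_inner_nested_sum.
apply: cvgMl_tmp; rewrite -E.
have {E} : cvgn (fun N => \sum_(n < N) (-1) ^+ n * nested_sum R (rev s) n).
  have : all (fun x => 0 < x)%N (rev s) by rewrite all_rev.
  have : (0 < size (rev s))%N by rewrite size_rev.
  by case: (rev s) => // k rks _; exact: nested_sum_alternating_cvg.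
case/cvg_ex => l; rewrite -cvg_shiftS => hl.
by apply/cvg_ex; exists l.
Qed.

Lemma W_cvg a b : 2 ^+ b.+1 * \sum_(n < N.+1) (-1) ^+ n * weight_sum a b.+1 n
  @[N --> \oo] --> W R (a + b.+1) b.+1.
Proof.
rewrite /W (@sum_tuple_seq _ _ _
  (fun s => all (fun x => 0 < x)%N s && (sumn s == (a + b.+1)%N))
  (compositions a b.+1) (Tbar R) (compositions_uniq _ _)); last first.
  by move=> s; rewrite mem_compositions.
rewrite (_ : (fun N => _) = fun N => \sum_(s <- compositions a b.+1)
  2 ^+ size s * \sum_(n < N.+1) (-1) ^+ n * nested_sum R (rev s) n).
  apply: cvg_sum_seq => s; rewrite mem_compositions => /and3P[/eqP sb _ /andP[sp _]].
  by apply: Tbar_cvg; rewrite ?sb.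
apply: funext => N; rewrite /weight_sum.
rewrite (eq_bigr _ (fun i _ => mulr_sumr _ _ _ _)) exchange_big mulr_sumr.
by apply: eq_big_seq => s /size_compositions ->.
Qed.

End WeightSum.

(** * Formal power series *)

Section FormalPowerSeries.
Variable A : comNzRingType.

(** The coefficient ring is arbitrary so that the construction can be iterated: series in two
    variables are [fps (fps R)], on which [ring] still works. *)
Definition fps := nat -> A.
Implicit Types F G H : fps.

HB.instance Definition _ := gen_eqMixin fps.
HB.instance Definition _ := gen_choiceMixin fps.

Definition fps_add F G : fps := fun n => F n + G n.
Definition fps_opp F : fps := fun n => - F n.
Definition fps_const (c : A) : fps := fun n => if n is 0%N then c else 0.
Definition fps_mul F G : fps := fun n => \sum_(i < n.+1) F i * G (n - i)%N.

(** The ring laws of the Cauchy product are inherited from polynomials, since a coefficient below N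
    depends only on the truncations at N. *)
Let trunc (N : nat) F : {poly A} := \poly_(i < N) F i.

Let coef_trunc_mul N F G n : (n < N)%N -> (trunc N F * trunc N G)`_n = fps_mul F G n.
Proof.
move=> nN; rewrite coefM; apply: eq_bigr => i _; have := ltn_ord i => iN.
by rewrite !coef_poly !ifT //; lia.
Qed.

Let coef_trunc_mul_congr N (p q : {poly A}) F n : (n < N)%N ->
  (forall m, (m < N)%N -> p`_m = q`_m) -> (trunc N F * p)`_n = (trunc N F * q)`_n.
Proof.
move=> nN pq; rewrite !coefM; apply: eq_bigr => i _; rewrite pq //; lia.
Qed.

Let fps_addA : associative fps_add.
Proof. by move=> F G H; apply: funext => n; exact: addrA. Qed.
Let fps_addC : commutative fps_add.
Proof. by move=> F G; apply: funext => n; exact: addrC. Qed.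
Let fps_add0 : left_id (fps_const 0) fps_add.
Proof. by move=> F; apply: funext => -[|n]; exact: add0r. Qed.
Let fps_addN : left_inverse (fps_const 0) fps_opp fps_add.
Proof. by move=> F; apply: funext => -[|n]; exact: addNr. Qed.
HB.instance Definition _ := GRing.isZmodule.Build fps fps_addA fps_addC fps_add0 fps_addN.

Let fps_mulC : commutative fps_mul.
Proof.
by move=> F G; apply: funext => n; rewrite -!(@coef_trunc_mul n.+1) // mulrC.
Qed.
Let fps_mulA : associative fps_mul.
Proof.
move=> F G H; apply: funext => n; have nn := ltnSn n.
rewrite (fps_mulC (fps_mul F G)) -!(@coef_trunc_mul n.+1) //.
have E K L m : (m < n.+1)%N -> (trunc n.+1 (fps_mul K L))`_m = (trunc n.+1 K * trunc n.+1 L)`_m.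
  by move=> mn; rewrite coef_poly mn coef_trunc_mul.
rewrite (coef_trunc_mul_congr _ nn (@E _ _)) [RHS](coef_trunc_mul_congr _ nn (@E _ _)).
by rewrite mulrA (mulrC (trunc n.+1 H)).
Qed.
Let fps_mul1 : left_id (fps_const 1) fps_mul.
Proof.
move=> F; apply: funext => n; rewrite /fps_mul big_ord_recl mul1r subn0 big1 ?addr0 //.
by move=> i _; rewrite mul0r.
Qed.
Let fps_mulDl : left_distributive fps_mul fps_add.
Proof.
move=> F G H; apply: funext => n; rewrite /fps_mul /fps_add -big_split.
by apply: eq_bigr => i _; rewrite mulrDl.
Qed.
Let fps_1neq0 : fps_const 1 != 0 :> fps.
Proof. by apply/eqP => /(congr1 (@^~ 0%N)) /eqP; rewrite oner_eq0. Qed.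
HB.instance Definition _ := GRing.Zmodule_isComNzRing.Build fps
  fps_mulA fps_mulC fps_mul1 fps_mulDl fps_1neq0.

Lemma fpsDE F G n : (F + G : fps) n = F n + G n. Proof. by []. Qed.
Lemma fpsBE F G n : (F - G : fps) n = F n - G n. Proof. by []. Qed.
Lemma fpsME F G n : (F * G : fps) n = \sum_(i < n.+1) F i * G (n - i)%N.
Proof. by []. Qed.

Lemma fps_constME c F n : (fps_const c * F : fps) n = c * F n.
Proof.
rewrite fpsME big_ord_recl subn0 big1 ?addr0 // => i _; exact: mul0r.
Qed.

Definition fps_X : fps := fun n => (n == 1%N)%:R.

Lemma fps_XME F n : (fps_X * F : fps) n = if n is n'.+1 then F n' else 0.
Proof.
rewrite fpsME; case: n => [|n]; first by rewrite big_ord1 mul0r.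
rewrite !big_ord_recl big1 => [|i _]; last by rewrite /fps_X /= mul0r.
by rewrite /fps_X /= mul0r add0r mul1r addr0 subSS subn0.
Qed.

End FormalPowerSeries.

(** * Complex-valued functions of a real variable *)

Section ComplexDerivative.
Variable R : realType.
Implicit Types (f g : R -> R[i]) (x : R) (z d e : R[i]).

Local Notation Re := (@complex.Re R).
Local Notation Im := (@complex.Im R).

Lemma complexP z e : Re z = Re e -> Im z = Im e -> z = e.
Proof. by case: z => ? ?; case: e => ? ? /= -> ->. Qed.

Lemma cReD z e : Re (z + e) = Re z + Re e. Proof. by case: z; case: e. Qed.
Lemma cImD z e : Im (z + e) = Im z + Im e. Proof. by case: z; case: e. Qed.
Lemma cReN z : Re (- z) = - Re z. Proof. by case: z. Qed.
Lemma cImN z : Im (- z) = - Im z. Proof. by case: z. Qed.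
Lemma cReM z e : Re (z * e) = Re z * Re e - Im z * Im e.
Proof. by case: z; case: e. Qed.
Lemma cImM z e : Im (z * e) = Re z * Im e + Im z * Re e.
Proof. by case: z; case: e. Qed.
Lemma cReJ z : Re z^*%C = Re z. Proof. by case: z. Qed.
Lemma cImJ z : Im z^*%C = - Im z. Proof. by case: z. Qed.

(** Componentwise, because the argument is real and in the end only an imaginary part is submitted
    to the mean value theorem. *)
Definition is_cderive x f d :=
  is_derive x 1 (fun u => Re (f u)) (Re d) /\ is_derive x 1 (fun u => Im (f u)) (Im d).

Lemma is_cderive_eq x f d e : is_cderive x f d -> d = e -> is_cderive x f e.
Proof. by move=> h <-. Qed.

Lemma is_cderive_cst x z : is_cderive x (fun=> z) 0.
Proof. by split; exact: is_derive_cst. Qed.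

Lemma is_cderiveD x f g d e : is_cderive x f d -> is_cderive x g e ->
  is_cderive x (fun u => f u + g u) (d + e).
Proof.
move=> [f1 f2] [g1 g2]; split.
  rewrite cReD (_ : (fun u => _) = (fun u => Re (f u)) + (fun u => Re (g u))).
    exact: is_deriveD.
  by apply: funext => u; rewrite cReD.
rewrite cImD (_ : (fun u => _) = (fun u => Im (f u)) + (fun u => Im (g u))).
  exact: is_deriveD.
by apply: funext => u; rewrite cImD.
Qed.

Lemma is_cderiveM x f g d e : is_cderive x f d -> is_cderive x g e ->
  is_cderive x (fun u => f u * g u) (d * g x + f x * e).
Proof.
move=> [f1 f2] [g1 g2]; split.
  rewrite (_ : (fun u => _) = (fun u => Re (f u)) * (fun u => Re (g u)) -
                              (fun u => Im (f u)) * (fun u => Im (g u))).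
    apply: is_derive_eq (is_deriveB (is_deriveM f1 g1) (is_deriveM f2 g2)) _.
    by rewrite cReD !cReM; rewrite /GRing.scale /=; ring.
  by apply: funext => u; rewrite cReM.
rewrite (_ : (fun u => _) = (fun u => Re (f u)) * (fun u => Im (g u)) +
                            (fun u => Im (f u)) * (fun u => Re (g u))).
  apply: is_derive_eq (is_deriveD (is_deriveM f1 g2) (is_deriveM f2 g1)) _.
  by rewrite cImD !cImM; rewrite /GRing.scale /=; ring.
by apply: funext => u; rewrite cImM.
Qed.

Lemma is_cderive_sum n x (f : 'I_n -> R -> R[i]) (d : 'I_n -> R[i]) :
  (forall i, is_cderive x (f i) (d i)) ->
  is_cderive x (fun u => \sum_(i < n) f i u) (\sum_(i < n) d i).
Proof.
elim: n f d => [|n IH] f d H.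
  rewrite big_ord0 (_ : (fun u => _) = fun=> 0); first exact: is_cderive_cst.
  by apply: funext => u; rewrite big_ord0.
rewrite big_ord_recl (_ : (fun u => _) =
  fun u => f ord0 u + \sum_(i < n) f (lift ord0 i) u).
  by apply: is_cderiveD => //; apply: IH.
by apply: funext => u; rewrite big_ord_recl.
Qed.

Lemma is_cderiveJ x f d : is_cderive x f d -> is_cderive x (fun u => (f u)^*%C) d^*%C.
Proof.
move=> [f1 f2]; split.
  rewrite cReJ (_ : (fun u => _) = fun u => Re (f u)) //.
  by apply: funext => u; rewrite cReJ.
rewrite cImJ (_ : (fun u => _) = - (fun u => Im (f u))); first exact: is_deriveN.
by apply: funext => u; rewrite cImJ.
Qed.

Lemma is_cderiveZ x f d z : is_cderive x f d -> is_cderive x (fun u => z * f u) (z * d).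
Proof.
move=> h; apply: is_cderive_eq (is_cderiveM (is_cderive_cst x z) h) _.
by rewrite mul0r add0r.
Qed.

Lemma is_cderive_logM x f g d e : is_cderive x f (f x * d) -> is_cderive x g (g x * e) ->
  is_cderive x (fun u => f u * g u) (f x * g x * (d + e)).
Proof. by move=> hf hg; apply: is_cderive_eq (is_cderiveM hf hg) _; ring. Qed.

Lemma is_cderive_logX x f d n : is_cderive x f (f x * d) ->
  is_cderive x (fun u => f u ^+ n) (f x ^+ n * (n%:R * d)).
Proof.
move=> h; elim: n => [|n IH].
  rewrite mul0r mulr0 (_ : (fun u => _) = fun=> 1); first exact: is_cderive_cst.
  by apply: funext => u; rewrite expr0.
rewrite (_ : (fun u => _) = fun u => f u * f u ^+ n).
  apply: is_cderive_eq (is_cderive_logM h IH) _.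
  by rewrite exprS -natr1; ring.
by apply: funext => u; rewrite exprS.
Qed.

Lemma is_cderiveX x f d n : is_cderive x f d ->
  is_cderive x (fun u => f u ^+ n.+1) (n.+1%:R * f x ^+ n * d).
Proof.
move=> h; elim: n => [|n IH].
  rewrite (_ : (fun u => _) = f); first by rewrite expr0 !mul1r.
  by apply: funext => u; rewrite expr1.
rewrite (_ : (fun u => _) = fun u => f u * f u ^+ n.+1).
  apply: is_cderive_eq (is_cderiveM h IH) _.
  by rewrite !exprS -(natr1 n.+1); ring.
by apply: funext => u; rewrite exprS.
Qed.

(** With z the formal variable, this is the coefficient of z^a in e^(-zU) times the series with
    coefficients F. *)
Definition twist (U : R -> R[i]) (F : nat -> R -> R[i]) (a : nat) (x : R) : R[i] :=
  \sum_(i < a.+1) (- U x) ^+ i / i`!%:R * F (a - i)%N x.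

(** The exponential is an integrating factor: if the series F has derivative z dU F + G, then
    e^(-zU) F has derivative e^(-zU) G. In coefficients the cancellation is a shift of the index by
    one. *)
Lemma is_cderive_twist x U F (dU : R[i]) (G : nat -> R[i]) a :
  is_cderive x U dU ->
  (forall b, is_cderive x (F b) (dU * (if b is b'.+1 then F b' x else 0) + G b)) ->
  is_cderive x (twist U F a) (\sum_(i < a.+1) (- U x) ^+ i / i`!%:R * G (a - i)%N).
Proof.
move=> hU hF.
pose e i u : R[i] := (- U u) ^+ i / i`!%:R.
have he i : is_cderive x (e i) (- dU * (if i is i'.+1 then e i' x else 0)).
  case: i => [|i].
    rewrite mulr0 /e (_ : (fun u => _) = fun=> 1); first exact: is_cderive_cst.
    by apply: funext => u; rewrite expr0 fact0 divr1.
  have hN : is_cderive x (fun u => - U u) (- dU).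
    apply: is_cderive_eq (_ : is_cderive x _ (-1 * dU)) _; last by rewrite mulN1r.
    rewrite (_ : (fun u => _) = fun u => -1 * U u); first exact: is_cderiveZ.
    by apply: funext => u; rewrite mulN1r.
  rewrite (_ : e i.+1 = fun u => i.+1`!%:R^-1 * (- U u) ^+ i.+1).
    apply: is_cderive_eq (is_cderiveZ _ (is_cderiveX i hN)) _.
    have f0 : i`!%:R != 0 :> R[i] by rewrite pnatr_eq0 -lt0n fact_gt0.
    have i0 : i.+1%:R != 0 :> R[i] by rewrite pnatr_eq0.
    by rewrite factS natrM /e; field; rewrite f0 /= ?natr1 ?nat1r ?i0 ?andbT.
  by apply: funext => u; rewrite mulrC.
apply: is_cderive_eq.
  by apply: is_cderive_sum => i; apply: is_cderiveM; [exact: he|exact: hF].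
rewrite (eq_bigr (fun i : 'I_a.+1 =>
    ((- dU * (if (i : nat) is i'.+1 then e i' x else 0)) * F (a - i)%N x
     + dU * (e i x * (if (a - i)%N is b'.+1 then F b' x else 0)))
    + e i x * G (a - i)%N)); last by move=> i _; rewrite /e; ring.
rewrite big_split /= [X in X + _](_ : _ = 0) ?add0r //.
rewrite big_split /= [X in X + _](_ : _ = \sum_(i < a) (- dU * e i x * F (a - i.+1)%N x)).
  rewrite [X in _ + X](_ : _ = \sum_(i < a) (dU * (e i x * F (a - i.+1)%N x))).
    by rewrite -big_split big1 //= => i _; ring.
  rewrite big_ord_recr /= subnn !mulr0 addr0; apply: eq_bigr => i _.
  by rewrite -(subnSK (ltn_ord i)).
by rewrite big_ord_recl mulr0 mul0r add0r.
Qed.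

End ComplexDerivative.

(** * The path from the real axis to i *)

Section Path.
Variable R : realType.
Implicit Types (w : R).

(** [rho] is the positive root of r^2 + 2 r cos w = 1, the polar equation of the circle; [rhoV] is
    its inverse and [dlog_rho] its logarithmic derivative. *)
Definition hypc w : R := Num.sqrt (1 + cos w ^+ 2).
Definition rho w : R := hypc w - cos w.
Definition rhoV w : R := hypc w + cos w.
Definition dlog_rho w : R := sin w / hypc w.

Lemma hypc_gt0 w : 0 < hypc w.
Proof. by rewrite sqrtr_gt0 ltr_pwDl // sqr_ge0. Qed.

Lemma hypc_sqr w : hypc w ^+ 2 = 1 + cos w ^+ 2.
Proof. by rewrite sqr_sqrtr // addr_ge0 // sqr_ge0. Qed.

Lemma rho_mulV w : rho w * rhoV w = 1.
Proof. by rewrite /rho /rhoV -subr_sqr hypc_sqr addrK. Qed.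

Lemma hypc_gt_cos w : `|cos w| < hypc w.
Proof.
rewrite -(@ltr_pXn2r _ 2) ?nnegrE ?normr_ge0 ?sqrtr_ge0 //.
by rewrite hypc_sqr real_normK ?num_real // ltrDr.
Qed.

Lemma rho_gt0 w : 0 < rho w.
Proof. by rewrite subr_gt0; apply: le_lt_trans (hypc_gt_cos w); exact: ler_norm. Qed.

Lemma rhoV_gt0 w : 0 < rhoV w.
Proof. by rewrite -(pmulr_rgt0 _ (rho_gt0 w)) rho_mulV. Qed.

Lemma is_derive_hypc w : is_derive w 1 hypc (- cos w * sin w / hypc w).
Proof.
have h0 : 0 < 1 + cos w ^+ 2 :> R by rewrite ltr_pwDl // sqr_ge0.
have h1 : is_derive w 1 (fun u => 1 + cos u ^+ 2 : R) (- 2 * cos w * sin w).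
  rewrite (_ : (fun u => _) = cst 1 + cos ^+ 2); last by apply: funext.
  apply: is_derive_eq (is_deriveD (is_derive_cst _ _ _) (is_deriveX 2 (is_derive_cos w))) _.
  by rewrite /GRing.scale /= expr1; ring.
apply: is_derive_eq (@is_derive1_comp _ Num.sqrt (fun u => 1 + cos u ^+ 2) w _ _
  (is_derive1_sqrt h0) h1) _.
by rewrite -/(hypc w); field; rewrite gt_eqF ?hypc_gt0.
Qed.

Lemma is_derive_rho w : is_derive w 1 rho (rho w * dlog_rho w).
Proof.
rewrite (_ : rho = hypc - cos); last by apply: funext.
apply: is_derive_eq (is_deriveB (is_derive_hypc w) (is_derive_cos w)) _.
by rewrite /dlog_rho /= !fctE; field; rewrite gt_eqF ?hypc_gt0.
Qed.

Lemma is_derive_rhoV w : is_derive w 1 rhoV (- rhoV w * dlog_rho w).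
Proof.
rewrite (_ : rhoV = hypc + cos); last by apply: funext.
apply: is_derive_eq (is_deriveD (is_derive_hypc w) (is_derive_cos w)) _.
by rewrite /dlog_rho /= !fctE; field; rewrite gt_eqF ?hypc_gt0.
Qed.

Lemma is_derive_ln_rho w : is_derive w 1 (fun u => ln (rho u)) (dlog_rho w).
Proof.
apply: is_derive_eq (@is_derive1_comp _ (@ln R) rho w _ _
  (is_derive1_ln (rho_gt0 w)) (is_derive_rho w)) _.
by rewrite mulKf // gt_eqF // rho_gt0.
Qed.

Local Open Scope complex_scope.

(** On the circle (1 - t)/(1 + t) = conj t, hence V = - log (conj t). This explains why [logV]
    differs from [logU] only by the sign of the real part. *)
Definition pt w : R[i] := (rho w * cos w) +i* (rho w * sin w).
Definition ptV w : R[i] := (rhoV w * cos w) +i* (- (rhoV w * sin w)).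
Definition logU w : R[i] := ln (rho w) +i* w.
Definition logV w : R[i] := (- ln (rho w)) +i* w.
Definition dU w : R[i] := dlog_rho w +i* 1.
Definition dV w : R[i] := (- dlog_rho w) +i* 1.

Lemma pt_mulV w : pt w * ptV w = 1.
Proof.
have h := rho_mulV w; have cs := cos2Dsin2 w.
apply: complexP; rewrite ?cReM ?cImM /=.
  transitivity (rho w * rhoV w * (cos w ^+ 2 + sin w ^+ 2)); first by ring.
  by rewrite h cs mulr1.
by ring.
Qed.

(** This is dV = 2 dt/(1 - t^2) multiplied by 1/t - t, with dU = dt/t. *)
Lemma dV_pt w : dV w * (ptV w - pt w) = 2 * dU w.
Proof.
have h0 : hypc w != 0 by rewrite gt_eqF ?hypc_gt0.
have cs : sin w ^+ 2 = 1 - cos w ^+ 2 by apply/eqP; rewrite eq_sym subr_eq addrC cos2Dsin2.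
have hs := hypc_sqr w.
have two : 2 = 2 +i* 0 :> R[i] by rewrite -(rmorph_nat (real_complex R)).
rewrite two /dV /dU /pt /ptV /dlog_rho /rho /rhoV.
apply: complexP; rewrite ?cReM ?cImM ?cReD ?cImD ?cReN ?cImN /=.
  transitivity (2 * sin w / hypc w * (hypc w ^+ 2 - cos w ^+ 2)); first by field.
  by rewrite hs; ring.
transitivity (2 * (sin w ^+ 2 + cos w ^+ 2)); first by field.
by rewrite cs; ring.
Qed.

Lemma is_cderive_pt w : is_cderive w pt (pt w * dU w).
Proof.
split=> /=.
  rewrite (_ : (fun u => _) = rho * cos); last by apply: funext.
  apply: is_derive_eq (is_deriveM (is_derive_rho w) (is_derive_cos w)) _.
  by rewrite /GRing.scale /=; ring.
rewrite (_ : (fun u => _) = rho * sin); last by apply: funext.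
apply: is_derive_eq (is_deriveM (is_derive_rho w) (is_derive_sin w)) _.
by rewrite /GRing.scale /=; ring.
Qed.

Lemma is_cderive_ptV w : is_cderive w ptV (ptV w * - dU w).
Proof.
split=> /=.
  rewrite (_ : (fun u => _) = rhoV * cos); last by apply: funext.
  apply: is_derive_eq (is_deriveM (is_derive_rhoV w) (is_derive_cos w)) _.
  by rewrite /GRing.scale /=; ring.
rewrite (_ : (fun u => _) = - (rhoV * sin)); last by apply: funext.
apply: is_derive_eq (is_deriveN (is_deriveM (is_derive_rhoV w) (is_derive_sin w))) _.
by rewrite /GRing.scale /=; ring.
Qed.

Lemma is_cderive_logU w : is_cderive w logU (dU w).
Proof. by split=> /=; [exact: is_derive_ln_rho|exact: is_derive_id]. Qed.

Lemma is_cderive_logV w : is_cderive w logV (dV w).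
Proof.
split=> /=; last exact: is_derive_id.
rewrite (_ : (fun u => _) = - (fun u => ln (rho u))); last by apply: funext.
by apply: is_deriveN; exact: is_derive_ln_rho.
Qed.

Lemma dU_conj w : (dU w)^*%C = - dV w.
Proof. by rewrite /dU /dV; apply: complexP; rewrite ?cReN ?cImN /= ?opprK. Qed.

Lemma dV_conj w : (dV w)^*%C = - dU w.
Proof. by rewrite /dU /dV; apply: complexP; rewrite ?cReN ?cImN /= ?opprK. Qed.

End Path.

(** * The truncated generating series along the path *)

Section TruncatedSeries.
Variable R : realType.
Implicit Types (w : R) (a b N : nat).
Local Open Scope complex_scope.

Local Notation ws := (weight_sum R).

(** The power t^(2n - b) is written with the inverse of t to avoid a truncated subtraction in the
    exponent. *)
Definition partialA N a b w : R[i] :=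
  \sum_(n < N.+1) (2 ^+ b * ws a b n)%:C * (pt w ^+ (2 * n) * ptV w ^+ b).

Definition errA N a b w : R[i] :=
  (2 ^+ b * \sum_(m < N.+1) ws a b m)%:C * (pt w ^+ (2 * N) * ptV w ^+ b).

(** Since t^(2n-b-1) (1/t - t) = t^(2n-b-2) - t^(2n-b), multiplication by s - t replaces the inner
    sums by their increments g; the last inner sum is left over as boundary term. *)
Lemma summation_by_parts (A : comNzRingType) (g : nat -> A) (t s u v : A) b N :
  t * s = 1 -> v * (s - t) = 2 * u ->
  2 * u * \sum_(n < N.+1) (\sum_(m < n) g m) * (t ^+ (2 * n) * s ^+ b.+1) =
  v * (\sum_(n < N.+1) g n * (t ^+ (2 * n) * s ^+ b)
       - (\sum_(m < N.+1) g m) * (t ^+ (2 * N) * s ^+ b)).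
Proof.
move=> ts vst; elim: N => [|N IH].
  by rewrite !big_ord1 big_ord0 mul0r mulr0 subrr mulr0.
rewrite big_ord_recr [X in v * (X - _)]big_ord_recr /= mulrDr IH -vst.
rewrite [\sum_(m < N.+2) g m]big_ord_recr /=.
set S := \sum_(m < N.+1) g m; set B := \sum_(n < N.+1) _.
have -> : (2 * N.+1 = (2 * N).+2)%N by rewrite mulnS.
have e1 : t ^+ (2 * N).+2 * s ^+ b.+1 * s = t ^+ (2 * N) * s ^+ b.
  transitivity ((t * s) * (t * s) * (t ^+ (2 * N) * s ^+ b)); last by rewrite ts !mul1r.
  by rewrite !exprS; ring.
have e2 : t ^+ (2 * N).+2 * s ^+ b.+1 * t = t ^+ (2 * N).+2 * s ^+ b.
  transitivity ((t * s) * (t ^+ (2 * N).+2 * s ^+ b)); last by rewrite ts mul1r.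
  by rewrite [s ^+ b.+1]exprS; ring.
transitivity (v * (B - S * (t ^+ (2 * N) * s ^+ b)) + v * S *
  (t ^+ (2 * N).+2 * s ^+ b.+1 * s - t ^+ (2 * N).+2 * s ^+ b.+1 * t)); first by ring.
by rewrite e1 e2; ring.
Qed.

Lemma partialA0 N a w : partialA N a 0 w = (a == 0%N)%:R.
Proof.
rewrite /partialA big_ord_recl big1 => [|i _]; last first.
  by rewrite weight_sum0 andbF mulr0 mul0r.
by rewrite weight_sum0 andbT muln0 !expr0 !mul1r mulr1 addr0 rmorph_nat.
Qed.

Lemma is_cderive_partialA N a b w : is_cderive w (partialA N a b.+1)
  (dU w * (if a is a'.+1 then partialA N a' b.+1 w else 0)
   + dV w * (partialA N a b w - errA N a b w)).
Proof.
apply: is_cderive_eq.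
  apply: is_cderive_sum => n; apply: is_cderiveZ; apply: is_cderive_logM.
    apply: is_cderive_logX; exact: is_cderive_pt.
  apply: is_cderive_logX; exact: is_cderive_ptV.
have -> : dV w * (partialA N a b w - errA N a b w) = dU w *
    \sum_(n < N.+1) (2 ^+ b.+1 * \sum_(m < n) ws a b m)%:C * (pt w ^+ (2 * n) * ptV w ^+ b.+1).
  transitivity ((2 ^+ b)%:C * (dV w *
    (\sum_(n < N.+1) (ws a b n)%:C * (pt w ^+ (2 * n) * ptV w ^+ b)
       - (\sum_(m < N.+1) (ws a b m)%:C) * (pt w ^+ (2 * N) * ptV w ^+ b)))).
    rewrite mulrCA; congr (_ * _); rewrite mulrBr mulr_sumr; congr (_ - _).
      by apply: eq_bigr => i _; rewrite rmorphM -mulrA.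
    by rewrite /errA rmorphM rmorph_sum -mulrA.
  rewrite -(summation_by_parts (fun n => (ws a b n)%:C) b N (pt_mulV w) (dV_pt w)).
  rewrite !mulr_sumr; apply: eq_bigr => i _.
  by rewrite rmorphM [2 ^+ b.+1]exprS rmorphM rmorph_sum rmorph_nat; ring.
rewrite -mulrDr.
have -> : (if a is a'.+1 then partialA N a' b.+1 w else 0) =
  \sum_(n < N.+1) (2 ^+ b.+1 * (if a is a'.+1 then ws a' b.+1 n else 0))%:C *
    (pt w ^+ (2 * n) * ptV w ^+ b.+1).
  by case: a => //; rewrite big1 // => i _; rewrite mulr0 mul0r.
rewrite -big_split mulr_sumr; apply: eq_bigr => n _ /=.
rewrite -mulrDl -rmorphD -mulrDr.
have -> : (if a is a'.+1 then ws a' b.+1 n else 0) + \sum_(m < n) ws a b m =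
    (2 * n%:R - b.+1%:R) * ws a b.+1 n.
  by case: a => [|a]; rewrite ?weight_sum_step0 ?weight_sum_stepS ?add0r.
rewrite !rmorphM rmorphB rmorphM !rmorph_nat natrM.
by ring.
Qed.

(** Truncated coefficient of x^a y^b in A(x,y;t) + A(-y,-x;s) - 1: the substitution gives the sign
    and the swapped indices, and s = conj t gives the conjugation. *)
Definition symD N a b w : R[i] :=
  partialA N a b w + (-1) ^+ (a + b) * (partialA N b a w)^*%C - ((a == 0%N) && (b == 0%N))%:R.

Definition errD N a b w : R[i] :=
  - dV w * (if b is b'.+1 then errA N a b' w else 0)
  + (-1) ^+ (a + b) * dU w * (if a is a'.+1 then errA N b a' w else 0)^*%C.

Lemma natrJ (n : nat) : (n%:R : R[i])^*%C = n%:R.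
Proof. exact: (rmorph_nat (conjc : {rmorphism R[i] -> R[i]})). Qed.

Lemma deriv_conj w (x y z : R[i]) :
  (dU w * x + dV w * (y - z))^*%C = - dV w * x^*%C - dU w * (y^*%C - z^*%C).
Proof.
have := dV_conj w; have := dU_conj w; move: (dU w) (dV w) => u v uc vc.
transitivity (u^*%C * x^*%C + v^*%C * (y^*%C - z^*%C)); last by rewrite uc vc; ring.
by rewrite -rmorphB -!rmorphM -rmorphD.
Qed.

Lemma is_cderive_symD N a b w : is_cderive w (symD N a b)
  (dU w * (if a is a'.+1 then symD N a' b w else 0)
   + dV w * (if b is b'.+1 then symD N a b' w else 0) + errD N a b w).
Proof.
have J0 : (0 : R[i])^*%C = 0 by exact: (natrJ 0).
have cA a' b' : is_cderive w (partialA N a' b')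
    (if b' is b''.+1 then
     (dU w * (if a' is a''.+1 then partialA N a'' b' w else 0)
     + dV w * (partialA N a' b'' w - errA N a' b'' w)) else 0).
  case: b' => [|b']; last exact: is_cderive_partialA.
  rewrite (_ : partialA N a' 0 = fun=> (a' == 0%N)%:R); first exact: is_cderive_cst.
  by apply: funext => u; rewrite partialA0.
apply: is_cderive_eq.
  apply: is_cderiveD; last exact: is_cderive_cst.
  apply: is_cderiveD; first exact: cA.
  by apply: is_cderiveZ; apply: is_cderiveJ; exact: cA.
(* When a = 0 or b = 0 one of the two series contributes a constant; the depth-zero coefficient 1
   that then appears on the right is cancelled by the term -1 of [symD]. *)
rewrite addr0 /errD /symD; case: a => [|a]; case: b => [|b];
  rewrite ?deriv_conj ?J0 ?partialA0 ?natrJ ?addn0 ?add0n ?eqxx ?addSn ?addnS ?exprS /=.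
- by ring.
- by case: b => [|b] /=; rewrite ?mulr1n ?mulr0n; ring.
- by case: a => [|a] /=; rewrite ?mulr1n ?mulr0n; ring.
- by rewrite ?andbF /=; ring.
Qed.

Definition twisted N a b : R -> R[i] :=
  twist (@logV R) (fun b' => twist (@logU R) (fun a' => symD N a' b') a) b.

Definition errK N a b w : R[i] :=
  \sum_(j < b.+1) (- logV w) ^+ j / j`!%:R *
    \sum_(i < a.+1) (- logU w) ^+ i / i`!%:R * errD N (a - i) (b - j) w.

Lemma is_cderive_twisted N a b w : is_cderive w (twisted N a b) (errK N a b w).
Proof.
apply: (@is_cderive_twist _ _ _ _ (dV w) (fun b' =>
  \sum_(i < a.+1) (- logU w) ^+ i / i`!%:R * errD N (a - i) b' w)).
  exact: is_cderive_logV.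
move=> b'; apply: is_cderive_eq.
  apply: (@is_cderive_twist _ _ _ _ (dU w) (fun a' =>
    dV w * (if b' is b''.+1 then symD N a' b'' w else 0) + errD N a' b' w)).
    exact: is_cderive_logU.
  move=> a'; rewrite addrA; exact: is_cderive_symD.
rewrite (eq_bigr _ (fun i _ => mulrDr _ _ _)) big_split; congr (_ + _).
case: b' => [|b']; first by rewrite mulr0 big1 // => i _; rewrite !mulr0.
by rewrite mulr_sumr; apply: eq_bigr => i _; rewrite mulrCA.
Qed.

End TruncatedSeries.

(** * Estimates along the path *)

Section Estimates.
Variable R : realType.
Implicit Types (w : R) (a b N : nat) (z : R[i]).
Local Open Scope complex_scope.

Local Notation Re := (@complex.Re R).
Local Notation Im := (@complex.Im R).

Lemma derive_ge0_le (f df : R -> R) (x y : R) : x <= y ->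
  (forall u : R, x <= u <= y -> is_derive u 1 f (df u)) ->
  (forall u, x <= u <= y -> 0 <= df u) -> f x <= f y.
Proof.
move=> xy hf df0.
have [u uxy||c] := @MVT_segment _ f df x y xy.
- by apply: hf; apply/andP; move: uxy; rewrite in_itv /= => /andP[? ?]; split; exact: ltW.
- apply: derivable_within_continuous => u; rewrite in_itv /= => uxy.
  exact: (@ex_derive _ _ _ _ _ _ _ (hf u uxy)).
rewrite in_itv /= => /df0 dfc e.
by rewrite -subr_ge0 e mulr_ge0 // subr_ge0.
Qed.

Lemma quarter_cos_ge0 w : 0 <= w <= pi / 2 -> 0 <= cos w.
Proof.
move=> /andP[w0 w1]; apply: cos_ge0_pihalf; rewrite w1 andbT.
by apply: le_trans w0; rewrite oppr_le0 divr_ge0 ?pi_ge0.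
Qed.

Lemma quarter_sin_ge0 w : 0 <= w <= pi / 2 -> 0 <= sin w.
Proof.
move=> /andP[w0 w1]; apply: sin_ge0_pi; rewrite w0 /=.
by apply: le_trans w1 _; have := @pi_ge0 R; lra.
Qed.

Lemma hypc_ge1 w : 1 <= hypc w.
Proof. by rewrite -[leLHS]sqrtr1 ler_sqrt ?lerDl ?sqr_ge0 // addr_ge0 // sqr_ge0. Qed.

Lemma rho_le1 w : 0 <= w <= pi / 2 -> rho w <= 1.
Proof.
move=> /quarter_cos_ge0 c0; have h1 := rho_mulV w; have h2 := rho_gt0 w.
have h3 : 1 <= rhoV w by have := hypc_ge1 w; rewrite /rhoV; lra.
by rewrite -h1 ler_peMr // ltW.
Qed.

(** Near i the modulus has logarithmic speed at least 1/2; elsewhere it stays away from 1. Indeed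
    [hypc w] > 2 sin w forces cos^2 >= 3/5, so that [rhoV] squared, at least 1 + 4 cos^2, exceeds
    2. *)
Lemma dlog_rho_or w : 0 <= w <= pi / 2 ->
  2^-1 <= dlog_rho w \/ rho w ^+ 2 <= 2^-1.
Proof.
move=> w01; have c0 := quarter_cos_ge0 w01; have s0 := quarter_sin_ge0 w01.
have h0 := hypc_gt0 w; have h2 := hypc_sqr w; have cs := cos2Dsin2 w.
have [hs|hs] := leP (hypc w) (2 * sin w).
  by left; rewrite ler_pdivlMr // -ler_pdivlMl ?invr_gt0 // invrK.
right; have s4 : 4 * sin w ^+ 2 <= hypc w ^+ 2.
  rewrite (_ : 4 * sin w ^+ 2 = (2 * sin w) ^+ 2); last by ring.
  by rewrite lerXn2r ?nnegrE ?mulr_ge0 // ltW.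
have ch : cos w <= hypc w by apply: le_trans (ltW (hypc_gt_cos w)); exact: ler_norm.
have V2 : 2 <= rhoV w ^+ 2.
  have : cos w ^+ 2 <= hypc w * cos w by rewrite expr2 ler_wpM2r.
  rewrite (_ : rhoV w ^+ 2 = hypc w ^+ 2 + 2 * (hypc w * cos w) + cos w ^+ 2); last first.
    by rewrite /rhoV; ring.
  by move: cs; lra.
have e : rho w ^+ 2 * rhoV w ^+ 2 = 1 by rewrite -exprMn rho_mulV expr1n.
have v0 : 0 < rhoV w ^+ 2 by apply: lt_le_trans V2.
by rewrite -(ler_pM2r v0) e; lra.
Qed.

(** The function is compared with a [g] whose derivative dominates rho^(2N+2). The two terms of [g]
    serve the two alternatives of [dlog_rho_or]: a power of rho where the speed is at least 1/2, a
    linear term with slope 2^-(N+1) where rho^2 <= 1/2. *)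
Lemma path_estimate N (f df : R -> R) (C : R) : 0 <= C -> f 0 = 0 ->
  (forall u : R, is_derive u 1 f (df u)) ->
  (forall u : R, 0 <= u <= pi / 2 ->
     `|df u| <= C * (Num.sqrt N.+2%:R * rho u ^+ (2 * N.+1))) ->
  `|f (pi / 2)| <= 6 * C * (Num.sqrt N.+2%:R)^-1.
Proof.
move=> C0 f0 hf bf; set s : R := Num.sqrt N.+2%:R.
have s0 : 0 < s by rewrite sqrtr_gt0 ltr0n.
have ss : s ^+ 2 = N.+2%:R by rewrite sqr_sqrtr // ler0n.
pose g (u : R) : R := N.+1%:R^-1 * rho u ^+ (2 * N.+1) + 2^-1 ^+ N.+1 * u.
pose dg (u : R) : R := 2 * rho u ^+ (2 * N.+1) * dlog_rho u + 2^-1 ^+ N.+1.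
have hg (u : R) : is_derive u 1 g (dg u).
  rewrite (_ : g = N.+1%:R^-1 *: (@rho R) ^+ (2 * N.+1) + 2^-1 ^+ N.+1 *: id).
    apply: is_derive_eq (is_deriveD (is_deriveZ _ (is_deriveX _ (is_derive_rho u)))
      (is_deriveZ _ (is_derive_id _ _))) _.
    rewrite /GRing.scale /= /dg mulr1; congr (_ + _).
    rewrite -[in RHS](@prednK (2 * N.+1)) // exprSr natrM.
    have : N.+1%:R != 0 :> R by rewrite pnatr_eq0.
    by move: (N.+1%:R : R) => c c0; field.
  by apply: funext => v; rewrite /g !fctE.
have dgE (u : R) : 0 <= u <= pi / 2 -> rho u ^+ (2 * N.+1) <= dg u.
  move=> u01; have r0 := ltW (rho_gt0 u).
  have rp : 0 <= rho u ^+ (2 * N.+1) by rewrite exprn_ge0.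
  have d0 : 0 <= dlog_rho u by rewrite divr_ge0 ?quarter_sin_ge0 // ltW ?hypc_gt0.
  have [h|h] := dlog_rho_or u01; rewrite /dg.
    have : 0 <= 2^-1 ^+ N.+1 :> R by rewrite exprn_ge0.
    have : rho u ^+ (2 * N.+1) * 2^-1 <= rho u ^+ (2 * N.+1) * dlog_rho u.
      by rewrite ler_wpM2l.
    by rewrite -mulrA; move: (rho u ^+ _ * dlog_rho u) => *; lra.
  have : rho u ^+ (2 * N.+1) <= 2^-1 ^+ N.+1 by rewrite exprM lerXn2r ?nnegrE ?sqr_ge0.
  have : 0 <= 2 * rho u ^+ (2 * N.+1) * dlog_rho u.
    by apply: mulr_ge0 => //; exact: mulr_ge0.
  by lra.
have pi0 : 0 <= pi / 2 :> R by rewrite divr_ge0 ?pi_ge0.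
have key (e : R) : e = 1 \/ e = -1 ->
    C * s * g 0 + e * f 0 <= C * s * g (pi / 2) + e * f (pi / 2).
  move=> e1; apply: (@derive_ge0_le (fun u => C * s * g u + e * f u)
    (fun u => C * s * dg u + e * df u)) => // u.
  move=> u01; have := bf _ u01; have := dgE _ u01.
  move=> /(ler_wpM2l (mulr_ge0 C0 (ltW s0))); rewrite -/s mulrA => h1.
  by rewrite ler_norml => /andP[h2 h3]; case: e1 => ->; lra.
have k1 := key 1 (or_introl erefl); have k2 := key (-1) (or_intror erefl).
(* The power of rho contributes at most 1/(N+1), the linear term at most 2/(N+1) because pi/2 <
   2. *)
have gb : g (pi / 2) - g 0 <= 3 * N.+1%:R^-1.
  have r1 : rho (pi / 2 : R) = 1.
    by rewrite /rho /hypc cos_pihalf expr0n addr0 sqrtr1 subr0.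
  have n1 : (2^-1) ^+ N.+1 <= N.+1%:R^-1 :> R.
    rewrite exprVn lef_pV2 ?posrE ?ltr0n ?exprn_gt0 // -natrX ler_nat.
    by apply: ltnW; exact: ltn_expl.
  have p2 : pi / 2 <= 2 :> R by exact/ltW/pihalf_lt2.
  have : 0 <= rho 0 ^+ (2 * N.+1) :> R by rewrite exprn_ge0 // ltW ?rho_gt0.
  have : 0 <= N.+1%:R^-1 :> R by [].
  move=> i0 rr; rewrite /g r1 expr1n mulr0 addr0 mulr1.
  have h1 := mulr_ge0 i0 rr.
  have : 2^-1 ^+ N.+1 * (pi / 2) <= N.+1%:R^-1 * 2 :> R.
    by apply: ler_pM => //; rewrite exprn_ge0.
  move: h1; move: (N.+1%:R^-1 * rho 0 ^+ _) (2^-1 ^+ N.+1 * (pi / 2)).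
  by move: (N.+1%:R^-1 : R) => x y z; lra.
have fb : `|f (pi / 2)| <= C * s * (g (pi / 2) - g 0).
  by rewrite ler_norml; move: k1 k2; rewrite f0; move=> *; apply/andP; split; lra.
apply: le_trans fb _; apply: le_trans (ler_wpM2l (mulr_ge0 C0 (ltW s0)) gb) _.
rewrite (_ : C * s * (3 * _) = C * (3 * (s / N.+1%:R))); last by ring.
rewrite (_ : 6 * C * _ = C * (3 * (2 * s^-1))); last by ring.
(* The factor 6 is 3 * 2, from s / (N+1) <= 2 / s, that is N + 2 <= 2 (N + 1). *)
rewrite !ler_wpM2l // ler_pdivrMr ?ltr0n // mulrAC ler_pdivlMr // -expr2 ss.
by rewrite -natrM ler_nat; lia.
Qed.

(** * Bounded functions and small error terms on the path *)

Lemma norm_le_ReIm z : `|z| <= (`|Re z| + `|Im z|)%:C.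
Proof.
rewrite normc_def lecR -[leRHS]ger0_norm ?addr_ge0 // -sqrtr_sqr ler_sqrt ?sqr_ge0 //.
rewrite -(real_normK (num_real (Re z))) -(real_normK (num_real (Im z))).
rewrite sqrrD addrAC lerDl mulrn_wge0 // mulr_ge0 //.
Qed.

Lemma Im_le_norm z (r : R) : `|z| <= r%:C -> `|Im z| <= r.
Proof.
rewrite normc_def lecR; apply: le_trans; rewrite -sqrtr_sqr ler_sqrt ?lerDr ?sqr_ge0 //.
by rewrite addr_ge0 ?sqr_ge0.
Qed.

Lemma norm_real (x : R) : `|x%:C| = `|x|%:C.
Proof. by rewrite normc_def /= expr0n addr0 sqrtr_sqr. Qed.

Lemma norm_conj z : `|z^*%C| = `|z|.
Proof. by rewrite !normc_def cReJ cImJ sqrrN. Qed.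

Lemma norm_pt w : `|pt w| = (rho w)%:C.
Proof.
rewrite normc_def /pt /= !exprMn -mulrDr cos2Dsin2 mulr1 sqrtr_sqr ger0_norm //.
exact/ltW/rho_gt0.
Qed.

Lemma norm_ptV w : `|ptV w| = (rhoV w)%:C.
Proof.
rewrite normc_def /ptV /= sqrrN !exprMn -mulrDr cos2Dsin2 mulr1 sqrtr_sqr ger0_norm //.
exact/ltW/rhoV_gt0.
Qed.

Definition bounded_on_path (g : R -> R[i]) :=
  exists2 B : R, 0 <= B & forall w, 0 <= w <= pi / 2 -> `|g w| <= B%:C.

Definition small_on_path (f : nat -> R -> R[i]) :=
  exists2 C : R, 0 <= C & forall N w, 0 <= w <= pi / 2 ->
    `|f N w| <= (C * (Num.sqrt N.+1%:R * rho w ^+ (2 * N)))%:C.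

Let weight_ge0 N w : 0 <= Num.sqrt N.+1%:R * rho w ^+ (2 * N).
Proof. by rewrite mulr_ge0 ?sqrtr_ge0 ?exprn_ge0 // ltW ?rho_gt0. Qed.

Lemma boundedM g h : bounded_on_path g -> bounded_on_path h ->
  bounded_on_path (fun w => g w * h w).
Proof.
move=> [B B0 hB] [B' B'0 hB']; exists (B * B'); first by rewrite mulr_ge0.
by move=> w w01; rewrite normrM rmorphM ler_pM ?normr_ge0 ?hB ?hB'.
Qed.

Lemma bounded_cst z : bounded_on_path (fun=> z).
Proof.
exists (`|Re z| + `|Im z|); first by rewrite addr_ge0.
by move=> w _; exact: norm_le_ReIm.
Qed.

Lemma boundedX g n : bounded_on_path g -> bounded_on_path (fun w => g w ^+ n).
Proof.
move=> hg; elim: n => [|n IH]; first exact: bounded_cst.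
rewrite (_ : (fun w => _) = fun w => g w * g w ^+ n); first exact: boundedM.
by apply: funext => w; rewrite exprS.
Qed.

Lemma smallD f g : small_on_path f -> small_on_path g ->
  small_on_path (fun N w => f N w + g N w).
Proof.
move=> [B B0 hB] [B' B'0 hB']; exists (B + B'); first by rewrite addr_ge0.
move=> N w w01; rewrite mulrDl rmorphD.
by apply: le_trans (ler_normD _ _) _; apply: lerD; [exact: hB|exact: hB'].
Qed.

Lemma small0 : small_on_path (fun _ _ => 0).
Proof. by exists 0 => // N w _; rewrite normr0 mul0r. Qed.

Lemma small_sum n (f : 'I_n -> nat -> R -> R[i]) :
  (forall i, small_on_path (f i)) -> small_on_path (fun N w => \sum_(i < n) f i N w).
Proof.
elim: n f => [|n IH] f hf.
  rewrite (_ : (fun N w => _) = fun _ _ => 0); first exact: small0.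
  by apply: funext => N; apply: funext => w; rewrite big_ord0.
rewrite (_ : (fun N w => _) =
    fun N w => f ord0 N w + \sum_(i < n) f (lift ord0 i) N w).
  by apply: smallD => //; apply: IH.
by apply: funext => N; apply: funext => w; rewrite big_ord_recl.
Qed.

Lemma smallM g f : bounded_on_path g -> small_on_path f ->
  small_on_path (fun N w => g w * f N w).
Proof.
move=> [B B0 hB] [B' B'0 hB']; exists (B * B'); first by rewrite mulr_ge0.
by move=> N w w01; rewrite normrM -mulrA rmorphM ler_pM ?normr_ge0 ?hB ?hB'.
Qed.

Lemma small_conj f : small_on_path f -> small_on_path (fun N w => (f N w)^*%C).
Proof. by move=> [B B0 hB]; exists B => // N w w01; rewrite norm_conj hB. Qed.

Lemma small_errA a b : small_on_path (fun N => errA N a b).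
Proof.
have [C C0 hC] := weight_sum_bound R a b.
(* On the path [rhoV] is at most 3, as [hypc] <= 2 and cos <= 1. *)
exists (2 ^+ b * C * 3 ^+ b); first by rewrite !mulr_ge0 ?exprn_ge0.
move=> N w w01; rewrite /errA !normrM norm_real !normrX norm_pt norm_ptV.
rewrite -!(rmorphXn (real_complex R)) -!(rmorphM (real_complex R)) lecR.
have /andP[h1 h2] := hC N.+1.
rewrite ger0_norm ?mulr_ge0 ?exprn_ge0 //.
rewrite [leRHS](_ : _ =
  2 ^+ b * (C * Num.sqrt N.+1%:R) * (rho w ^+ (2 * N) * 3 ^+ b)); last by ring.
have r0 := ltW (rho_gt0 w); have v0 := ltW (rhoV_gt0 w).
apply: ler_pM; rewrite ?mulr_ge0 ?exprn_ge0 ?ler_wpM2l ?exprn_ge0 //.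
rewrite lerXn2r ?nnegrE //.
have hh := hypc_sqr w; have h0 := hypc_gt0 w; have c1 := cos_le1 w.
have c0 := quarter_cos_ge0 w01.
have : hypc w <= 2.
  rewrite -(@ler_pXn2r _ 2) ?nnegrE ?ltW // hh.
  have : cos w ^+ 2 <= 1 by rewrite exprn_ile1.
  by lra.
by rewrite /rhoV; lra.
Qed.

Lemma bounded_dU : bounded_on_path (@dU R).
Proof.
exists 2 => // w w01; apply: le_trans (norm_le_ReIm _) _; rewrite lecR /= normr1.
have h0 := hypc_ge1 w; have := sin_max w => sm.
have : `|dlog_rho w| <= 1; last by lra.
rewrite normrM normfV (ger0_norm (ltW (hypc_gt0 w))) ler_pdivrMr ?hypc_gt0 // mul1r.
exact: le_trans h0.
Qed.

Lemma bounded_dV : bounded_on_path (@dV R).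
Proof.
have [B B0 hB] := bounded_dU; exists B => // w w01.
rewrite (_ : dV w = - (dU w)^*%C) ?normrN ?norm_conj ?hB //.
by rewrite dU_conj opprK.
Qed.

Lemma bounded_logU : bounded_on_path (@logU R).
Proof.
(* Here 5 = 3 + 2: the modulus of ln rho is ln rhoV < rhoV <= 3, and 0 <= w < 2. *)
exists 5 => // w w01; apply: le_trans (norm_le_ReIm _) _; rewrite lecR /=.
have /andP[w0 w1] := w01.
have p2 : pi / 2 < 2 :> R by exact: pihalf_lt2.
rewrite (ger0_norm w0).
have r0 := rho_gt0 w; have v0 := rhoV_gt0 w.
have -> : rho w = (rhoV w)^-1.
  have vn : rhoV w != 0 by rewrite gt_eqF.
  by apply: (mulIf vn); rewrite rho_mulV mulVf.
rewrite lnV ?posrE // normrN ger0_norm; last first.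
  by apply: ln_ge0; have := hypc_ge1 w; have := quarter_cos_ge0 w01; rewrite /rhoV; lra.
have := ln_sublinear v0; have hh := hypc_sqr w; have h0 := hypc_gt0 w; have c1 := cos_le1 w.
have c0 := quarter_cos_ge0 w01.
have : hypc w <= 2.
  rewrite -(@ler_pXn2r _ 2) ?nnegrE ?ltW // hh.
  have : cos w ^+ 2 <= 1 by rewrite exprn_ile1.
  by lra.
by rewrite /rhoV; lra.
Qed.

Lemma bounded_logV : bounded_on_path (@logV R).
Proof.
have [B B0 hB] := bounded_logU; exists B => // w w01.
rewrite (_ : logV w = - (logU w)^*%C) ?normrN ?norm_conj ?hB //.
by apply: complexP; rewrite ?cReN ?cImN ?cReJ ?cImJ /= ?opprK.
Qed.

Lemma boundedN g : bounded_on_path g -> bounded_on_path (fun w => - g w).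
Proof. by move=> [B B0 hB]; exists B => // w w01; rewrite normrN hB. Qed.

Lemma small_errK a b : small_on_path (fun N => errK N a b).
Proof.
have sD a' b' : small_on_path (fun N => errD N a' b').
  apply: smallD.
    apply: smallM; first exact: boundedN bounded_dV.
    by case: b' => [|b']; [exact: small0|exact: small_errA].
  apply: smallM; first by apply: boundedM; [exact: bounded_cst|exact: bounded_dU].
  by apply: small_conj; case: a' => [|a']; [exact: small0|exact: small_errA].
apply: small_sum => j; apply: smallM.
  apply: boundedM; last exact: bounded_cst.
  by apply: boundedX; exact: boundedN bounded_logV.
apply: small_sum => i; apply: smallM => //.
apply: boundedM; last exact: bounded_cst.
by apply: boundedX; exact: boundedN bounded_logU.
Qed.

End Estimates.

(** * The endpoint t = i *)

Section Endpoint.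
Variable R : realType.
Implicit Types (a b N : nat) (z : R[i]).
Local Open Scope complex_scope.
Local Open Scope classical_set_scope.

Local Notation Re := (@complex.Re R).
Local Notation Im := (@complex.Im R).

Lemma Im_real z : z \is Num.real -> Im z = 0.
Proof. by rewrite realE !lecE => /orP[] /andP[/eqP h _]; [exact: h|exact: esym h]. Qed.

Lemma real_real (x : R) : x%:C \is Num.real.
Proof. by rewrite realE !lecE /= eqxx /= -realE num_real. Qed.

Lemma conj_real z : z \is Num.real -> z^*%C = z.
Proof. by move=> /Im_real h; apply: complexP; rewrite ?cReJ ?cImJ // h oppr0. Qed.

Lemma Im_twisted_origin N a b : Im (twisted N a b (0 : R)) = 0.
Proof.
apply: Im_real.
have eR (x : R) y : y = 0 -> (x +i* y) \is Num.real by move=> ->; exact: real_real.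
have hU : logU (0 : R) \is Num.real by exact: eR.
have hV : logV (0 : R) \is Num.real by exact: eR.
have hp : pt (0 : R) \is Num.real by apply: eR; rewrite sin0 mulr0.
have hq : ptV (0 : R) \is Num.real by apply: eR; rewrite sin0 mulr0 oppr0.
have hA a' b' : partialA N a' b' (0 : R) \is Num.real.
  by apply: rpred_sum => i _; rewrite rpredM ?real_real // rpredM ?rpredX.
have hD a' b' : symD N a' b' (0 : R) \is Num.real.
  rewrite rpredB ?realn // rpredD // rpredM ?conj_real //.
  by rewrite rpredX // rpredN rpred1.
apply: rpred_sum => j _; rewrite rpredM //.
  by rewrite rpredM ?rpredX ?rpredN // rpredV realn.
apply: rpred_sum => i _; rewrite rpredM //.
by rewrite rpredM ?rpredX ?rpredN // rpredV realn.
Qed.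

Definition alternating_sum N a b : R :=
  2 ^+ b * \sum_(n < N.+1) (-1) ^+ n * weight_sum R a b n.

Definition weight_lim a b : R :=
  if b is b'.+1 then W R (a + b) b else (a == 0%N)%:R.

Lemma alternating_sum_cvg a b : alternating_sum N a b @[N --> \oo] --> weight_lim a b.
Proof.
case: b => [|b]; last exact: W_cvg.
rewrite (_ : (fun N => _) = fun=> (a == 0%N)%:R); first exact: cvg_cst.
apply: funext => N; rewrite /alternating_sum mul1r big_ord_recl big1 => [|i _].
  by rewrite weight_sum0 andbT mul1r addr0.
by rewrite weight_sum0 andbF mulr0.
Qed.

Lemma rho_pihalf : rho (pi / 2 : R) = 1.
Proof. by rewrite /rho /hypc cos_pihalf expr0n addr0 sqrtr1 subr0. Qed.

Lemma pt_pihalf : pt (pi / 2 : R) = 'i%C.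
Proof. by rewrite /pt rho_pihalf cos_pihalf sin_pihalf mulr0 mulr1. Qed.

Lemma ptV_pihalf : ptV (pi / 2 : R) = - 'i%C.
Proof.
rewrite /ptV /rhoV /hypc cos_pihalf sin_pihalf expr0n !addr0 sqrtr1.
by apply: complexP; rewrite ?cReN ?cImN /= ?mulr0 ?mulr1 ?oppr0.
Qed.

Lemma log_pihalf : (logU (pi / 2 : R) = (pi / 2)%:C * 'i%C) *
                   (logV (pi / 2 : R) = (pi / 2)%:C * 'i%C).
Proof.
by rewrite /logU /logV rho_pihalf ln1 oppr0; split; apply: complexP;
   rewrite ?cReM ?cImM /=; ring.
Qed.

Lemma partialA_pihalf N a b :
  partialA N a b (pi / 2) = (alternating_sum N a b)%:C * (- 'i%C) ^+ b.
Proof.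
rewrite /partialA pt_pihalf ptV_pihalf /alternating_sum mulr_sumr rmorph_sum mulr_suml.
apply: eq_bigr => n _; rewrite exprM sqr_i mulrA; congr (_ * _).
by rewrite (mulrCA (2 ^+ b)) mulrC (rmorphM (real_complex R) ((-1) ^+ n))
  (rmorphXn (real_complex R)) (rmorphN1 (real_complex R)).
Qed.

Definition symD_val (x : nat -> nat -> R) a b : R[i] :=
  (x a b)%:C * (- 'i%C) ^+ b + (-1) ^+ (a + b) * ((x b a)%:C * 'i%C ^+ a)
  - ((a == 0%N) && (b == 0%N))%:R.

(** The form of [twisted] at t = i, where both logarithms equal i pi/2. The table [x] is a parameter
    so that truncated sums and their limits share one formula. *)
Definition twisted_val (x : nat -> nat -> R) a b : R[i] :=
  \sum_(j < b.+1) (- ((pi / 2)%:C * 'i%C)) ^+ j / j`!%:R *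
    \sum_(i < a.+1) (- ((pi / 2)%:C * 'i%C)) ^+ i / i`!%:R * symD_val x (a - i) (b - j).

Lemma conjM (z e : R[i]) : (z * e)^*%C = z^*%C * e^*%C.
Proof. exact: (rmorphM (conjc : {rmorphism R[i] -> R[i]})). Qed.

Lemma conj_Ni b : ((- 'i%C) ^+ b)^*%C = 'i%C ^+ b :> R[i].
Proof.
rewrite (rmorphXn (conjc : {rmorphism R[i] -> R[i]})); congr (_ ^+ _).
by apply: complexP; rewrite /= ?oppr0 ?opprK.
Qed.

Lemma twisted_pihalf N a b :
  twisted N a b (pi / 2) = twisted_val (alternating_sum N) a b.
Proof.
rewrite /twisted /twist /twisted_val !log_pihalf; apply: eq_bigr => j _; congr (_ * _).
apply: eq_bigr => i _; congr (_ * _).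
rewrite /symD /symD_val !partialA_pihalf; congr (_ + _ * _ - _).
by rewrite conjM conj_Ni conj_real ?real_real.
Qed.

Definition ccvg (z : nat -> R[i]) (l : R[i]) :=
  (Re (z n) @[n --> \oo] --> Re l) /\ (Im (z n) @[n --> \oo] --> Im l).

Lemma ccvgD u1 u2 (l1 l2 : R[i]) : ccvg u1 l1 -> ccvg u2 l2 ->
  ccvg (fun n => u1 n + u2 n) (l1 + l2).
Proof.
move=> [r1 i1] [r2 i2]; split.
  by rewrite (cReD l1 l2) (_ : (fun n => _) = fun n => Re (u1 n) + Re (u2 n));
    [apply: cvgD|apply: funext => n; rewrite cReD].
by rewrite (cImD l1 l2) (_ : (fun n => _) = fun n => Im (u1 n) + Im (u2 n));
  [apply: cvgD|apply: funext => n; rewrite cImD].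
Qed.

Lemma ccvgZ (c : R[i]) u l : ccvg u l -> ccvg (fun n => c * u n) (c * l).
Proof.
move=> [r1 i1]; split.
  rewrite (cReM c l) (_ : (fun n => _) = fun n => Re c * Re (u n) - Im c * Im (u n)).
    exact: (cvgB (@cvgMl_tmp _ _ _ _ _ (Re c) _ r1) (@cvgMl_tmp _ _ _ _ _ (Im c) _ i1)).
  by apply: funext => n; rewrite cReM.
rewrite (cImM c l) (_ : (fun n => _) = fun n => Re c * Im (u n) + Im c * Re (u n)).
  exact: (cvgD (@cvgMl_tmp _ _ _ _ _ (Re c) _ i1) (@cvgMl_tmp _ _ _ _ _ (Im c) _ r1)).
by apply: funext => n; rewrite cImM.
Qed.

Lemma ccvg_cst z : ccvg (fun=> z) z.
Proof. by split; exact: cvg_cst. Qed.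

Lemma ccvg_sum n (z : 'I_n -> nat -> R[i]) (l : 'I_n -> R[i]) :
  (forall i, ccvg (z i) (l i)) -> ccvg (fun m => \sum_(i < n) z i m) (\sum_(i < n) l i).
Proof.
elim: n z l => [|n IH] z l h.
  rewrite big_ord0 (_ : (fun m => _) = fun=> 0); first exact: ccvg_cst.
  by apply: funext => m; rewrite big_ord0.
rewrite big_ord_recl (_ : (fun m => _) = fun m => z ord0 m + \sum_(i < n) z (lift ord0 i) m).
  by apply: ccvgD => //; apply: IH.
by apply: funext => m; rewrite big_ord_recl.
Qed.

Lemma ccvg_real (x : nat -> R) (l : R) : x n @[n --> \oo] --> l ->
  ccvg (fun n => (x n)%:C) l%:C.
Proof. by move=> h; split => //=; exact: cvg_cst. Qed.

(** The truncated imaginary part vanishes at w = 0, where t = sqrt 2 - 1 is real, and changes by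
    O(1/sqrt N) along the path; at the endpoint it also converges to the left-hand side. *)
Lemma Im_twisted_weight_lim a b : Im (twisted_val weight_lim a b) = 0.
Proof.
have [_ c1] : ccvg (fun N => twisted_val (alternating_sum N) a b)
    (twisted_val weight_lim a b).
  have cA a' b' := ccvg_real (@alternating_sum_cvg a' b').
  apply: ccvg_sum => j; apply: ccvgZ; apply: ccvg_sum => i; apply: ccvgZ.
  apply: ccvgD; last exact: ccvg_cst.
  apply: ccvgD; last apply: ccvgZ.
    under eq_fun do rewrite mulrC; rewrite mulrC; exact: ccvgZ.
  under eq_fun do rewrite mulrC; rewrite mulrC; exact: ccvgZ.
have [C C0 hC] := @small_errK R a b.
have c2 : Im (twisted_val (alternating_sum N) a b) @[N --> \oo] --> 0.
  apply/cvgr0Pnorm_le => e e0.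
  have : \forall N \near \oo, `|(6 * C) * (Num.sqrt N.+1%:R)^-1 : R| <= e.
    move: e e0; apply/cvgr0Pnorm_le.
    by rewrite -(mulr0 (6 * C)); apply: cvgMl_tmp; exact: cvg_inv_sqrt.
  case=> M _ hM; exists M.+1 => // N /= MN; have := hM N.-1.+1.
  case: N MN => // N MN; rewrite -twisted_pihalf => hN.
  have est : `|Im (twisted N.+1 a b (pi / 2))| <= 6 * C * (Num.sqrt N.+2%:R)^-1.
    apply: (@path_estimate _ N (fun u => Im (twisted N.+1 a b u))
      (fun u => Im (errK N.+1 a b u)) C C0).
    - exact: Im_twisted_origin.
    - by move=> u; have [] := is_cderive_twisted N.+1 a b u.
    - by move=> u u01; apply: Im_le_norm; exact: hC.
  apply: le_trans est _; apply: le_trans (ler_norm _) _; apply: hN => /=.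
  exact: ltnW.
by rewrite -(cvg_lim _ c1) // (cvg_lim _ c2).
Qed.

End Endpoint.

(** * Trigonometric power series *)

Lemma sum_parity_even (V : nmodType) (F : nat -> V) (n : nat) :
  \sum_(i < 2 * n) F i = \sum_(i < n) F (2 * i)%N + \sum_(i < n) F (2 * i).+1.
Proof.
elim: n => [|n IH]; first by rewrite !big_ord0 addr0.
rewrite mulnS !addSn add0n 2!big_ord_recr IH !big_ord_recr /=.
by rewrite -!addrA; congr (_ + _); rewrite addrCA.
Qed.

Lemma sum_parity_odd (V : nmodType) (F : nat -> V) (n : nat) :
  \sum_(i < (2 * n).+1) F i = \sum_(i < n.+1) F (2 * i)%N + \sum_(i < n) F (2 * i).+1.
Proof. by rewrite big_ord_recr sum_parity_even big_ord_recr /= addrAC. Qed.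

Section TrigonometricSeries.
Variable R : realType.

(** The variable of these three series is x^2: they are cos(pi x/2), sin(pi x/2)/x and sin(pi x)/(pi
    x). *)
Definition cos_fps : fps R := fun n => (-1) ^+ n * (pi / 2) ^+ (2 * n) / (2 * n)`!%:R.
Definition sin_fps : fps R := fun n => (-1) ^+ n * (pi / 2) ^+ (2 * n).+1 / (2 * n).+1`!%:R.
Definition sinc_fps : fps R := fun n => (-1) ^+ n * pi ^+ (2 * n) / (2 * n).+1`!%:R.

Lemma fact_inv_bin (m n : nat) : (m <= n)%N ->
  (m`!%:R)^-1 * ((n - m)`!%:R)^-1 = 'C(n, m)%:R / n`!%:R :> R.
Proof.
move=> mn; have f0 k : k`!%:R != 0 :> R by rewrite pnatr_eq0 -lt0n fact_gt0.
rewrite -(bin_fact mn) !natrM.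
have b0 : 'C(n, m)%:R != 0 :> R by rewrite pnatr_eq0 -lt0n bin_gt0.
by field; rewrite !f0 b0.
Qed.

(** In positive degree n this says that the binomial coefficients of 2n with even and with odd lower
    index have equal sums, that is (1 - 1)^(2n) = 0. *)
Lemma cos_sqrD_sin_sqr : cos_fps * cos_fps + fps_X R * (sin_fps * sin_fps) = 1.
Proof.
apply: funext => n; rewrite fpsDE fps_XME.
have cE : (cos_fps * cos_fps : fps R) n = (-1) ^+ n * (pi / 2) ^+ (2 * n) / (2 * n)`!%:R *
    \sum_(i < n.+1) 'C(2 * n, 2 * i)%:R.
  rewrite fpsME mulr_sumr; apply: eq_bigr => i _; have := ltn_ord i; rewrite ltnS => ni.
  have e := @fact_inv_bin (2 * i) (2 * n) ltac:(lia).
  rewrite -mulnBr in e; rewrite /cos_fps.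
  transitivity ((-1) ^+ i * (-1) ^+ (n - i) * ((pi / 2) ^+ (2 * i) * (pi / 2) ^+ (2 * (n - i)))
     * ((2 * i)`!%:R^-1 * (2 * (n - i))`!%:R^-1) : R); first by ring.
  rewrite e -!exprD subnKC // -mulnDr subnKC //; ring.
rewrite cE; case: n {cE} => [|n].
  by rewrite big_ord1 addr0 muln0 !expr0 fact0 bin0 divr1 !mulr1.
have -> : (sin_fps * sin_fps : fps R) n =
    - ((-1) ^+ n.+1 * (pi / 2) ^+ (2 * n.+1) / (2 * n.+1)`!%:R) *
    \sum_(i < n.+1) 'C(2 * n.+1, (2 * i).+1)%:R.
  rewrite fpsME mulr_sumr; apply: eq_bigr => i _; have := ltn_ord i; rewrite ltnS => ni.
  have e := @fact_inv_bin (2 * i).+1 (2 * n.+1) ltac:(lia).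
  have e2 : (2 * n.+1 - (2 * i).+1 = (2 * (n - i)).+1)%N by lia.
  rewrite e2 in e; rewrite /sin_fps.
  transitivity ((-1) ^+ i * (-1) ^+ (n - i) * ((pi / 2) ^+ (2 * i).+1 * (pi / 2) ^+ (2 * (n - i)).+1)
     * ((2 * i).+1`!%:R^-1 * (2 * (n - i)).+1`!%:R^-1) : R); first by ring.
  rewrite e -!exprD subnKC //.
  have -> : ((2 * i).+1 + (2 * (n - i)).+1 = 2 * n.+1)%N by lia.
  by rewrite [(-1) ^+ n.+1]exprS; ring.
set c := _ / _; rewrite mulNr -mulrBr [RHS](_ : _ = 0) //.
suff -> : \sum_(i < n.+2) 'C(2 * n.+1, 2 * i)%:R =
    \sum_(i < n.+1) 'C(2 * n.+1, (2 * i).+1)%:R :> R by rewrite subrr mulr0.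
have := exprBn (1 : R) 1 (2 * n.+1).
rewrite subrr expr0n mulnS /= -mulnS => /esym.
rewrite (sum_parity_odd (fun i => ((-1) ^+ i * 1 ^+ (2 * n.+1 - i) * 1 ^+ i) *+ 'C(2 * n.+1, i))).
move=> /eqP; rewrite addr_eq0 => /eqP h.
transitivity (\sum_(i < n.+2)
    ((-1) ^+ (2 * i) * 1 ^+ (2 * n.+1 - 2 * i) * 1 ^+ (2 * i)) *+ 'C(2 * n.+1, 2 * i) : R).
  by apply: eq_bigr => i _; rewrite exprM sqrrN !expr1n !mulr1.
rewrite h -sumrN; apply: eq_bigr => i _.
by rewrite exprS exprM sqrrN !expr1n !mulr1 mulNrn opprK.
Qed.

(** The double angle formula; its coefficients reduce to the sum 2^(2n) of the binomial coefficients
    of 2n+1 with odd lower index. *)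
Lemma sin_mul_cos n : 2 * (sin_fps * cos_fps : fps R) n = pi * sinc_fps n.
Proof.
have -> : (sin_fps * cos_fps : fps R) n =
    (-1) ^+ n * (pi / 2) ^+ (2 * n).+1 / (2 * n).+1`!%:R *
    \sum_(i < n.+1) 'C((2 * n).+1, (2 * i).+1)%:R.
  rewrite fpsME mulr_sumr; apply: eq_bigr => i _; have := ltn_ord i; rewrite ltnS => ni.
  have e := @fact_inv_bin (2 * i).+1 (2 * n).+1 ltac:(lia).
  rewrite subSS -mulnBr in e; rewrite /sin_fps /cos_fps.
  transitivity ((-1) ^+ i * (-1) ^+ (n - i) * ((pi / 2) ^+ (2 * i).+1 * (pi / 2) ^+ (2 * (n - i)))
     * ((2 * i).+1`!%:R^-1 * (2 * (n - i))`!%:R^-1) : R); first by ring.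
  rewrite e -!exprD subnKC //.
  have -> : ((2 * i).+1 + (2 * (n - i)) = (2 * n).+1)%N by lia.
  by ring.
have h : 2 * \sum_(i < n.+1) 'C((2 * n).+1, (2 * i).+1)%:R = 2 ^+ (2 * n).+1 :> R.
  have e3 : ((2 * n).+2 = 2 * n.+1)%N by rewrite mulnS.
  pose O := \sum_(i < n.+1) 'C((2 * n).+1, (2 * i).+1)%:R : R.
  pose E := \sum_(i < n.+1) 'C((2 * n).+1, 2 * i)%:R : R.
  have e1 : 2 ^+ (2 * n).+1 = E + O.
    rewrite -[2]/(1 + 1) exprDn e3.
    rewrite (sum_parity_even (fun i => (1 ^+ ((2 * n).+1 - i) * 1 ^+ i) *+ 'C((2 * n).+1, i))).
    by congr (_ + _); apply: eq_bigr => i _; rewrite !expr1n mulr1.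
  have e2 : 0 = E - O.
    transitivity ((1 - 1 : R) ^+ (2 * n).+1); first by rewrite subrr expr0n.
    rewrite exprBn e3 (sum_parity_even
      (fun i => ((-1) ^+ i * 1 ^+ ((2 * n).+1 - i) * 1 ^+ i) *+ 'C((2 * n).+1, i))).
    congr (_ + _); last rewrite -sumrN; apply: eq_bigr => i _.
      by rewrite exprM sqrrN !expr1n !mulr1.
    by rewrite exprS exprM sqrrN !expr1n !mulr1 mulNrn.
  by rewrite e1 -/O; lra.
rewrite mulrCA h /sinc_fps expr_div_n.
have t0 : 2 ^+ (2 * n).+1 != 0 :> R by rewrite expf_neq0.
have f0 : (2 * n).+1`!%:R != 0 :> R by rewrite pnatr_eq0 -lt0n fact_gt0.
by rewrite [pi ^+ _.+1]exprS; field; rewrite t0 f0.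
Qed.

End TrigonometricSeries.

(** * The symmetry relation *)

Section Symmetry.
Variable R : realType.
Implicit Types (a b : nat).
Local Open Scope complex_scope.

Local Notation Re := (@complex.Re R).
Local Notation Im := (@complex.Im R).
Local Notation wl := (weight_lim R).
Arguments weight_lim : simpl never.

(** The series M of the overview; the sign comes from (-i)^(2b+1) = (-1)^(b+1) i. *)
Definition odd_depth a b : R := (-1) ^+ b.+1 * wl (2 * a) (2 * b).+1.
Definition even_depth a b : R :=
  (-1) ^+ b * wl (2 * a) (2 * b) + (-1) ^+ a * wl (2 * b) (2 * a)
  - ((a == 0%N) && (b == 0%N))%:R.

Lemma even_depthC a b : even_depth a b = even_depth b a.
Proof. by rewrite /even_depth andbC [X in X - _]addrC. Qed.

Lemma signC n : (-1) ^+ n = ((-1) ^+ n : R)%:C.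
Proof. by rewrite (rmorphXn (real_complex R)) (rmorphN1 (real_complex R)). Qed.

Lemma exprNi_even b : (- 'i%C) ^+ (2 * b) = ((-1) ^+ b : R)%:C.
Proof. by rewrite exprM sqrrN sqr_i signC. Qed.
Lemma expri_even b : 'i%C ^+ (2 * b) = ((-1) ^+ b : R)%:C.
Proof. by rewrite exprM sqr_i signC. Qed.

Lemma cImCM (x : R) (z : R[i]) : Im (x%:C * z) = x * Im z.
Proof. by rewrite cImM /= mul0r addr0. Qed.
Lemma cReCM (x : R) (z : R[i]) : Re (x%:C * z) = x * Re z.
Proof. by rewrite cReM /= mul0r subr0. Qed.
Lemma cIm_nat n : Im n%:R = 0.
Proof. by rewrite -(rmorph_nat (real_complex R)). Qed.
Lemma cRe_nat n : Re n%:R = n%:R.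
Proof. by rewrite -(rmorph_nat (real_complex R)). Qed.

Lemma ImNi (z : R[i]) : Im (- 'i%C * z) = - Re z.
Proof. by rewrite cImM /=; ring. Qed.
Lemma ReNi (z : R[i]) : Re (- 'i%C * z) = Im z.
Proof. by rewrite cReM /=; ring. Qed.

Lemma Re_symD_ee a b : Re (symD_val wl (2 * a) (2 * b)) = even_depth a b.
Proof.
rewrite /symD_val exprNi_even expri_even signC !(cReD, cReN) !cReCM /= cRe_nat.
rewrite !muln_eq0 /= -mulnDr exprM sqrrN !expr1n mul1r /even_depth.
by rewrite (mulrC (wl _ _)) (mulrC (wl (2 * b) _)).
Qed.

Lemma Im_symD_eo a b : Im (symD_val wl (2 * a) (2 * b).+1) = odd_depth a b.
Proof.
rewrite /symD_val exprSr exprNi_even expri_even signC !(cImD, cImN) !cImCM cIm_nat /=.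
by rewrite !mulr0 addr0 oppr0 addr0 /odd_depth exprS; ring.
Qed.

Lemma Im_symD_oe a b : Im (symD_val wl (2 * a).+1 (2 * b)) = odd_depth b a.
Proof.
rewrite /symD_val exprSr exprNi_even expri_even signC !(cImD, cImN) !cImCM cIm_nat /=.
rewrite mulr0 add0r addSn exprS -mulnDr exprM sqrrN !expr1n /odd_depth exprS.
by ring.
Qed.

Lemma Re_symD_oo a b : Re (symD_val wl (2 * a).+1 (2 * b).+1) = 0.
Proof.
rewrite /symD_val !exprSr exprNi_even expri_even signC !(cReD, cReN) !cReCM cRe_nat /=.
by ring.
Qed.

Lemma exp_coef_even m :
  (- ((pi / 2)%:C * 'i%C)) ^+ (2 * m) / (2 * m)`!%:R = (cos_fps R m)%:C.
Proof.
rewrite -mulrN exprMn exprNi_even -(rmorphXn (real_complex R)).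
rewrite -(rmorph_nat (real_complex R)) -(fmorphV (real_complex R)).
by rewrite -!(rmorphM (real_complex R)) /cos_fps mulrC (mulrC (_ ^+ _)) mulrC.
Qed.

Lemma exp_coef_odd m :
  (- ((pi / 2)%:C * 'i%C)) ^+ (2 * m).+1 / (2 * m).+1`!%:R = (sin_fps R m)%:C * (- 'i%C).
Proof.
rewrite -mulrN exprMn [(- 'i%C) ^+ _]exprSr exprNi_even -(rmorphXn (real_complex R)).
rewrite -(rmorph_nat (real_complex R)) -(fmorphV (real_complex R)).
rewrite mulrA [LHS]mulrAC -!(rmorphM (real_complex R)) /sin_fps.
by rewrite (mulrC ((-1) ^+ m)).
Qed.

(** The vanishing imaginary part at the indices (2a, 2b+1), split by the parity of both exponents of
    -i pi/2. Even exponents give cosine coefficients, odd ones sine coefficients and a factor -i;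
    the total power of -i decides whether a real or an imaginary part of [symD_val] is selected, and
    the odd-odd part is zero. *)
Lemma fundamental_relation a b :
  \sum_(m < b.+1) \sum_(l < a.+1) cos_fps R m * (cos_fps R l * odd_depth (a - l) (b - m))
  - \sum_(m < b.+1) \sum_(l < a) sin_fps R m * (sin_fps R l * odd_depth (b - m) (a - l.+1))
  = \sum_(m < b.+1) \sum_(l < a.+1) sin_fps R m * (cos_fps R l * even_depth (a - l) (b - m)).
Proof.
have := Im_twisted_weight_lim R (2 * a) (2 * b).+1.
have e3 : ((2 * b).+2 = 2 * b.+1)%N by rewrite mulnS.
rewrite /twisted_val e3.
pose G (j : nat) : R[i] := \sum_(i < (2 * a).+1) (- ((pi / 2)%:C * 'i%C)) ^+ i / i`!%:R *
  symD_val wl (2 * a - i) ((2 * b).+1 - j).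
rewrite (sum_parity_even (fun j => (- ((pi / 2)%:C * 'i%C)) ^+ j / j`!%:R * G j)) cImD.
have ImS n (F : 'I_n -> R[i]) : Im (\sum_(i < n) F i) = \sum_(i < n) Im (F i).
  by apply: (big_morph Im) => [x y|//]; exact: cImD.
have ReS n (F : 'I_n -> R[i]) : Re (\sum_(i < n) F i) = \sum_(i < n) Re (F i).
  by apply: (big_morph Re) => [x y|//]; exact: cReD.
have GE (j : nat) : G j =
    \sum_(l < a.+1) (cos_fps R l)%:C * symD_val wl (2 * (a - l)) ((2 * b).+1 - j)
    + \sum_(l < a) (sin_fps R l)%:C * (- 'i%C) *
        symD_val wl (2 * (a - l.+1)).+1 ((2 * b).+1 - j).
  rewrite /G (sum_parity_odd (fun i => (- ((pi / 2)%:C * 'i%C)) ^+ i / i`!%:R *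
    symD_val wl (2 * a - i) ((2 * b).+1 - j))); congr (_ + _); apply: eq_bigr => l _.
    by rewrite exp_coef_even -mulnBr.
  rewrite exp_coef_odd; congr (_ * symD_val _ _ _); have := ltn_ord l; lia.
have ev (m : nat) : (m < b.+1)%N ->
    Im ((cos_fps R m)%:C * G (2 * m)%N) =
    \sum_(l < a.+1) cos_fps R m * (cos_fps R l * odd_depth (a - l) (b - m)).
  move=> mb; rewrite cImCM GE cImD !ImS -mulr_sumr.
  have eb : ((2 * b).+1 - 2 * m = (2 * (b - m)).+1)%N by lia.
  rewrite eb [X in _ + X]big1 ?addr0 => [|l _].
    by congr (_ * _); apply: eq_bigr => l _; rewrite cImCM Im_symD_eo.
  by rewrite -mulrA cImCM ImNi Re_symD_oo oppr0 mulr0.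
have od (m : nat) : (m < b.+1)%N ->
    Im ((sin_fps R m)%:C * (- 'i%C) * G (2 * m).+1) =
    - \sum_(l < a.+1) sin_fps R m * (cos_fps R l * even_depth (a - l) (b - m))
    - \sum_(l < a) sin_fps R m * (sin_fps R l * odd_depth (b - m) (a - l.+1)).
  move=> mb; rewrite -mulrA cImCM ImNi GE cReD !ReS.
  have eb : ((2 * b).+1 - (2 * m).+1 = 2 * (b - m))%N by lia.
  rewrite eb -!mulr_sumr -!mulrN -mulrDr; congr (_ * _).
  rewrite opprD; congr (- _ + _).
    by apply: eq_bigr => l _; rewrite cReCM Re_symD_ee.
  congr (- _); apply: eq_bigr => l _.
  by rewrite -mulrA cReCM ReNi Im_symD_oe.
rewrite !ImS [X in X + _](eq_bigr (fun m : 'I_b.+1 =>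
    \sum_(l < a.+1) cos_fps R m * (cos_fps R l * odd_depth (a - l) (b - m)))); last first.
  by move=> m _; rewrite exp_coef_even ev.
rewrite [X in _ + X](eq_bigr (fun m : 'I_b.+1 =>
    - \sum_(l < a.+1) sin_fps R m * (cos_fps R l * even_depth (a - l) (b - m))
    - \sum_(l < a) sin_fps R m * (sin_fps R l * odd_depth (b - m) (a - l.+1)))); last first.
  by move=> m _; rewrite exp_coef_odd od.
rewrite big_split !sumrN /= => h.
apply/eqP; rewrite -subr_eq0; apply/eqP; rewrite -[RHS]h.
by ring.
Qed.

(** * Series in two variables and the elimination *)

Definition fps_lift (u : fps R) : fps (fps R) := fun n => fps_const (u n).

Lemma fps_sumE (A : comNzRingType) n (F : 'I_n -> fps A) k :
  (\sum_(i < n) F i : fps A) k = \sum_(i < n) F i k.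
Proof. by elim/big_rec2: _ => // [|i x y _ <-]; [case: k|]. Qed.

Lemma fps_liftME (u : fps R) (F : fps (fps R)) a b :
  (fps_lift u * F : fps (fps R)) a b = \sum_(l < a.+1) u l * F (a - l)%N b.
Proof. by rewrite fpsME fps_sumE; apply: eq_bigr => l _; rewrite fps_constME. Qed.

Lemma fps_constM2E (u : fps R) (F : fps (fps R)) a b :
  (fps_const u * F : fps (fps R)) a b = \sum_(m < b.+1) u m * F a (b - m)%N.
Proof. by rewrite fps_constME fpsME. Qed.

Lemma fps_lift_mul (u v : fps R) : fps_lift u * fps_lift v = fps_lift (u * v).
Proof.
apply: funext => a; apply: funext => b; rewrite fps_liftME /fps_lift.
case: b => [|b]; first by rewrite /= fpsME.
by rewrite /= big1 // => i _; rewrite mulr0.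
Qed.

Lemma fps_const_mul (u v : fps R) : fps_const u * fps_const v = fps_const (u * v).
Proof.
apply: funext => a; rewrite fps_constME; case: a => [//|a].
exact: mulr0.
Qed.

Lemma odd_depth_symmetry a b :
  \sum_(i < a.+1) sinc_fps R i * odd_depth (a - i) b =
  \sum_(i < b.+1) sinc_fps R i * odd_depth (b - i) a.
Proof.
pose M : fps (fps R) := fun a b => odd_depth a b.
pose Mt : fps (fps R) := fun a b => odd_depth b a.
pose E : fps (fps R) := fun a b => even_depth a b.
(* The outer index is the power of x^2 and the inner one that of y^2, so [fps_lift] embeds series in
   x^2 and [fps_const] series in y^2. *)
pose cx := fps_lift (cos_fps R); pose cy : fps (fps R) := fps_const (cos_fps R).
pose sx := fps_lift (sin_fps R); pose sy : fps (fps R) := fps_const (sin_fps R).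
pose X := fps_X (fps R); pose Y : fps (fps R) := fps_const (fps_X R).
have px : cx * cx + X * (sx * sx) = 1.
  rewrite /cx /sx !fps_lift_mul; apply: funext => n; rewrite fpsDE fps_XME.
  have := cos_sqrD_sin_sqr R => /(congr1 (@^~ n)); rewrite fpsDE fps_XME.
  move=> h; apply: funext => k; rewrite fpsDE /fps_lift.
  case: n h => [|n] h; case: k => [|k] /=; rewrite -?h ?addr0 //.
  by move: h; rewrite addr0.
have py : cy * cy + Y * (sy * sy) = 1.
  rewrite /cy /sy /Y !fps_const_mul; apply: funext => -[|n].
    by rewrite fpsDE; exact: cos_sqrD_sin_sqr.
  by rewrite fpsDE /= addr0.
have e1 : cy * (cx * M) - sy * (X * (sx * Mt)) = sy * (cx * E).
  apply: funext => i; apply: funext => j.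
  rewrite !fpsBE !fps_constM2E.
  rewrite (eq_bigr _ (fun m _ => congr1 ( *%R _) (fps_liftME _ _ _ _))).
  rewrite [RHS](eq_bigr _ (fun m _ => congr1 ( *%R _) (fps_liftME _ _ _ _))).
  have := fundamental_relation i j.
  rewrite (eq_bigr _ (fun m _ => esym (mulr_sumr _ _ _ _))).
  rewrite [RHS](eq_bigr _ (fun m _ => esym (mulr_sumr _ _ _ _))) => <-.
  congr (_ - _); apply: eq_bigr => m _; rewrite -mulr_sumr; congr (_ * _).
  rewrite fps_XME; case: i => [|i]; first by rewrite big_ord0; case: (j - m)%N.
  by rewrite fps_liftME; apply: eq_bigr => l _; rewrite subSS.
(* The transpose of the first relation, E being symmetric. *)
have e2 : cx * (cy * Mt) - sx * (Y * (sy * M)) = sx * (cy * E).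
  apply: funext => i; apply: funext => j.
  rewrite !fpsBE !fps_liftME.
  rewrite (eq_bigr _ (fun m _ => congr1 ( *%R _) (fps_constM2E _ _ _ _))).
  rewrite [RHS](eq_bigr _ (fun m _ => congr1 ( *%R _) (fps_constM2E _ _ _ _))).
  have fr := fundamental_relation j i.
  rewrite [RHS](eq_bigr (fun m : 'I_i.+1 => \sum_(l < j.+1)
    sin_fps R m * (cos_fps R l * even_depth (j - l) (i - m)))); last first.
    by move=> m _; rewrite mulr_sumr; apply: eq_bigr => l _; rewrite even_depthC.
  rewrite -fr; congr (_ - _); apply: eq_bigr => m _; rewrite -mulr_sumr; congr (_ * _).
  rewrite fps_constME fps_XME; case: j {fr} => [|j]; first by rewrite big_ord0.
  by rewrite fps_constM2E; apply: eq_bigr => l _; rewrite subSS.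
(* Multiplying [e1] by sx cy and [e2] by cx sy and subtracting removes E; the squares then collect
   into [px] and [py]. *)
have key : sx * cx * M = sy * cy * Mt.
  apply/eqP; rewrite -subr_eq0; apply/eqP.
  transitivity (sx * cx * (cy * cy + Y * (sy * sy)) * M
                - sy * cy * (cx * cx + X * (sx * sx)) * Mt).
    by rewrite px py !mulr1.
  transitivity (sx * cy * (cy * (cx * M) - sy * (X * (sx * Mt)))
                - cx * sy * (cx * (cy * Mt) - sx * (Y * (sy * M)))); first by ring.
  by rewrite e1 e2; ring.
move: key; rewrite /sx /cx /sy /cy fps_lift_mul fps_const_mul.
move=> /(congr1 (fun F : fps (fps R) => 2 * F a b)).
rewrite fps_liftME fps_constM2E !mulr_sumr.
rewrite (eq_bigr (fun i : 'I_a.+1 => pi * (sinc_fps R i * odd_depth (a - i) b))); last first.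
  by move=> i _; rewrite mulrA sin_mul_cos -mulrA.
rewrite [RHS](eq_bigr (fun i : 'I_b.+1 => pi * (sinc_fps R i * odd_depth (b - i) a))); last first.
  by move=> i _; rewrite mulrA sin_mul_cos -mulrA.
by rewrite -!mulr_sumr; apply: mulfI; rewrite gt_eqF ?pi_gt0.
Qed.

End Symmetry.

(** * Even values of the alternating zeta function *)

Section Euler.
Variable R : realType.
Implicit Types (x u : R) (k n N : nat).
Local Open Scope classical_set_scope.
Local Notation zb := (zetabar R).

Lemma is_derive_add (f g : R -> R) x df dg : is_derive x 1 f df -> is_derive x 1 g dg ->
  is_derive x 1 (fun u => f u + g u) (df + dg).
Proof. by move=> hf hg; exact: (is_deriveD hf hg). Qed.

Lemma is_derive_mul (f g : R -> R) x df dg : is_derive x 1 f df -> is_derive x 1 g dg ->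
  is_derive x 1 (fun u => f u * g u) (df * g x + f x * dg).
Proof.
move=> hf hg; apply: is_derive_eq (is_deriveM hf hg) _.
by rewrite /GRing.scale /= addrC mulrC.
Qed.

Lemma is_derive_scale (c : R) (f : R -> R) x df : is_derive x 1 f df ->
  is_derive x 1 (fun u => c * f u) (c * df).
Proof. by move=> hf; exact: (is_deriveZ c hf). Qed.

Lemma is_derive_linear (c x : R) : is_derive x 1 (fun u => c * u) c.
Proof. by apply: is_derive_eq (is_derive_scale c (is_derive_id x 1)) _; rewrite mulr1. Qed.

Lemma is_derive_sin_scaled (c x : R) : is_derive x 1 (fun u => sin (c * u)) (c * cos (c * x)).
Proof.
apply: is_derive_eq (@is_derive1_comp _ sin (fun u => c * u) x _ _
  (is_derive_sin _) (is_derive_linear c x)) _.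
by rewrite mulrC.
Qed.

Lemma is_derive_cos_scaled (c x : R) : is_derive x 1 (fun u => cos (c * u)) (- c * sin (c * x)).
Proof.
apply: is_derive_eq (@is_derive1_comp _ cos (fun u => c * u) x _ _
  (is_derive_cos _) (is_derive_linear c x)) _.
by rewrite mulrC mulrN mulNr.
Qed.

(** * Even powers integrated against the Dirichlet kernel *)

Definition cos_term k x : R := (-1) ^+ k * x ^+ (2 * k) / (2 * k)`!%:R.
Definition sin_term k x : R := (-1) ^+ k * x ^+ (2 * k).+1 / (2 * k).+1`!%:R.

Lemma is_derive_pow n x : is_derive x 1 (fun u => u ^+ n.+1 / n.+1`!%:R) (x ^+ n / n`!%:R).
Proof.
have h : is_derive x 1 (fun u => u ^+ n.+1) (n.+1%:R * x ^+ n).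
  rewrite (_ : (fun u => _) = (@idfun R) ^+ n.+1); last by apply: funext => u; rewrite fctE.
  by apply: is_derive_eq (is_deriveX n.+1 (is_derive_id x 1)) _; rewrite /GRing.scale /= mulr1.
rewrite (_ : (fun u => _) = fun u => n.+1`!%:R^-1 * u ^+ n.+1); last first.
  by apply: funext => u; rewrite mulrC.
apply: is_derive_eq (is_derive_scale _ h) _.
have f0 : n`!%:R != 0 :> R by rewrite pnatr_eq0 -lt0n fact_gt0.
have : n.+1%:R != 0 :> R by rewrite pnatr_eq0.
rewrite factS natrM; move: (n.+1%:R : R) (n`!%:R : R) f0 => a b b0 a0.
by field; rewrite a0 b0.
Qed.

Lemma is_derive_sin_term k x : is_derive x 1 (sin_term k) (cos_term k x).
Proof.
rewrite (_ : sin_term k = fun u => (-1) ^+ k * (u ^+ (2 * k).+1 / (2 * k).+1`!%:R)).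
  by apply: is_derive_eq (is_derive_scale _ (is_derive_pow _ _)) _; rewrite mulrA.
by apply: funext => u; rewrite mulrA.
Qed.

Lemma is_derive_cos_termS k x : is_derive x 1 (cos_term k.+1) (- sin_term k x).
Proof.
have e : (2 * k.+1 = (2 * k).+2)%N by rewrite mulnS.
rewrite (_ : cos_term k.+1 = fun u => (-1) ^+ k.+1 * (u ^+ (2 * k).+2 / (2 * k).+2`!%:R)).
  apply: is_derive_eq (is_derive_scale _ (is_derive_pow _ _)) _.
  by rewrite exprS /sin_term; ring.
by apply: funext => u; rewrite /cos_term e -mulrA.
Qed.

(** A double integration by parts of [cos_term k] against cos((n+1)x), which lowers k by one. At pi
    only the cosine terms survive, and they carry the alternating even powers of 1/(n+1). *)
Fixpoint cos_primitive n k x : R :=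
  if k is k'.+1 then
    cos_term k x * (n.+1%:R^-1 * sin (n.+1%:R * x))
    - sin_term k' x * (n.+1%:R^-1 ^+ 2 * cos (n.+1%:R * x))
    + n.+1%:R^-1 ^+ 2 * cos_primitive n k' x
  else n.+1%:R^-1 * sin (n.+1%:R * x).

Lemma is_derive_cos_primitive n k x :
  is_derive x 1 (cos_primitive n k) (cos_term k x * cos (n.+1%:R * x)).
Proof.
have c0 : n.+1%:R != 0 :> R by rewrite pnatr_eq0.
have hs := is_derive_scale n.+1%:R^-1 (is_derive_sin_scaled n.+1%:R x).
have hc := is_derive_scale (n.+1%:R^-1 ^+ 2) (is_derive_cos_scaled n.+1%:R x).
elim: k => [|k IH].
  apply: is_derive_eq hs _; rewrite mulKf // /cos_term muln0 !expr0.
  by rewrite divr1 !mul1r.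
have h1 := is_derive_mul (is_derive_cos_termS k x) hs.
have h2 := is_derive_scale (-1) (is_derive_mul (is_derive_sin_term k x) hc).
rewrite (_ : cos_primitive n k.+1 = fun u =>
   cos_term k.+1 u * (n.+1%:R^-1 * sin (n.+1%:R * u))
   + (-1) * (sin_term k u * (n.+1%:R^-1 ^+ 2 * cos (n.+1%:R * u)))
   + n.+1%:R^-1 ^+ 2 * cos_primitive n k u).
  apply: is_derive_eq (is_derive_add (is_derive_add h1 h2) (is_derive_scale _ IH)) _.
  by move: (n.+1%:R : R) c0 => c c0; field.
by apply: funext => u; rewrite /= mulN1r.
Qed.

Lemma cos_primitive0 n k : cos_primitive n k 0 = 0.
Proof.
elim: k => [|k IH] /=; first by rewrite mulr0 sin0 mulr0.
by rewrite IH mulr0 sin0 /sin_term expr0n /= !(mulr0, mul0r) subr0 addr0.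
Qed.

Lemma sin_natpi n : sin (n%:R * pi : R) = 0 /\ cos (n%:R * pi : R) = (-1) ^+ n.
Proof.
elim: n => [|n [IHs IHc]]; first by rewrite mul0r sin0 cos0 expr0.
rewrite -natr1 mulrDl mul1r (sinD (n%:R * pi)) (cosD (n%:R * pi)) IHs IHc sinpi cospi exprS.
by split; ring.
Qed.

Lemma cos_primitive_pi n k : cos_primitive n k pi =
  \sum_(i < k) (-1) ^+ n / n.+1%:R ^+ (2 * i.+1) * sin_term (k - i.+1) pi.
Proof.
have [sn cn] := sin_natpi n.+1.
elim: k => [|k IH] /=; rewrite sn ?mulr0 ?big_ord0 // add0r cn IH.
rewrite big_ord_recl subSS subn0 muln1 mulr_sumr; congr (_ + _).
  by rewrite [(-1) ^+ n.+1]exprS exprVn; ring.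
apply: eq_bigr => i _; rewrite lift0 subSS [(2 * i.+2)%N]mulnS exprD exprVn [in RHS]invfM.
by move: (n.+1%:R ^- 2) (n.+1%:R ^- (2 * i.+1)) => c d; ring.
Qed.

Definition dirichlet_primitive N k x : R :=
  2^-1 * sin_term k x + \sum_(n < N) cos_primitive n k x.

Lemma dirichlet_kernel N x :
  2 * sin (2^-1 * x) * (2^-1 + \sum_(n < N) cos (n.+1%:R * x)) = sin ((N%:R + 2^-1) * x).
Proof.
elim: N => [|N IH]; first by rewrite big_ord0 addr0 add0r; field.
rewrite big_ord_recr addrA mulrDr IH /= -(natr1 N).
rewrite (_ : (N%:R + 2^-1) * x = (N%:R + 1) * x - 2^-1 * x); last by field.
rewrite (_ : (N%:R + 1 + 2^-1) * x = (N%:R + 1) * x + 2^-1 * x); last by field.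
by rewrite sinB sinD; ring.
Qed.

Lemma is_derive_dirichlet_primitive N k x : is_derive x 1 (dirichlet_primitive N k)
  (cos_term k x * (2^-1 + \sum_(n < N) cos (n.+1%:R * x))).
Proof.
apply: is_derive_eq.
  apply: is_derive_add; first exact: is_derive_scale (is_derive_sin_term k x).
  rewrite (_ : (fun u => _) = \sum_(n < N) (fun u => cos_primitive n k u)).
    exact: (is_derive_sum (fun i : 'I_N => is_derive_cos_primitive i k x)).
  by apply: funext => u; rewrite fct_sumE.
by rewrite mulrDr mulr_sumr mulrC.
Qed.


Lemma sin_le_id x : 0 <= x -> sin x <= x.
Proof.
move=> x0; rewrite -subr_ge0.
have := @derive_ge0_le R (fun u => u + -1 * sin u) (fun u => 1 + -1 * cos u) 0 x x0.
rewrite /= sin0 mulr0 addr0 mulN1r; apply=> u _.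
by rewrite mulN1r subr_ge0 cos_le1.
Qed.

Lemma cos_ge_quadratic x : 0 <= x -> 1 - 2^-1 * x ^+ 2 <= cos x.
Proof.
move=> x0.
have := @derive_ge0_le R (fun u => cos u + 2^-1 * (u * u)) (fun u => - sin u + 2^-1 * (1 * u + u * 1)) 0 x x0.
rewrite /= cos0 !mulr0 addr0 => h.
rewrite lerBlDr expr2; apply: h => u /andP[u0 _].
  exact: (is_derive_add (is_derive_cos u) (is_derive_scale _
    (is_derive_mul (is_derive_id u 1) (is_derive_id u 1)))).
by have := sin_le_id u0; lra.
Qed.

(** From sin x >= x - x^3/6, where x^2 <= 4. *)
Lemma sin_ge_third x : 0 <= x <= 2 -> x / 3 <= sin x.
Proof.
move=> /andP[x0 x2].
have := @derive_ge0_le R (fun u => sin u + -1 * u + 6^-1 * (u * (u * u)))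
  (fun u => cos u + -1 * 1 + 6^-1 * (1 * (u * u) + u * (1 * u + u * 1))) 0 x x0.
rewrite /= sin0 !mulr0 !addr0 => h.
have {}h : 0 <= sin x + -1 * x + 6^-1 * (x * (x * x)).
  apply: h => u /andP[u0 _].
    have hi := is_derive_id u 1.
    exact: (is_derive_add (is_derive_add (is_derive_sin u) (is_derive_scale _ hi))
      (is_derive_scale _ (is_derive_mul hi (is_derive_mul hi hi)))).
  by have := cos_ge_quadratic u0; rewrite expr2; lra.
have xx : x * x <= 4 by have := ler_pM x0 x0 x2 x2; lra.
have : x * (x * x) <= x * 4 by rewrite ler_wpM2l.
by lra.
Qed.

Lemma mean_value_le (f df : R -> R) (x y B : R) : x <= y ->
  (forall u : R, x <= u <= y -> is_derive u 1 f (df u)) ->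
  (forall u, x <= u <= y -> `|df u| <= B) -> `|f y - f x| <= B * (y - x).
Proof.
move=> xy hf dfB.
have [u uxy||c] := @MVT_segment _ f df x y xy.
- by apply: hf; apply/andP; move: uxy; rewrite in_itv /= => /andP[? ?]; split; exact: ltW.
- apply: derivable_within_continuous => u; rewrite in_itv /= => uxy.
  exact: (@ex_derive _ _ _ _ _ _ _ (hf u uxy)).
rewrite in_itv /= => /dfB dfc ->.
have yx : 0 <= y - x by rewrite subr_ge0.
by rewrite normrM (ger0_norm yx) ler_wpM2r.
Qed.

Lemma norm_power_term_le (m : nat) x : 0 <= x <= pi ->
  `|x ^+ m / m`!%:R| <= x ^+ m.
Proof.
move=> /andP[x0 _]; rewrite ger0_norm ?divr_ge0 ?exprn_ge0 //.
rewrite ler_pdivrMr ?ltr0n ?fact_gt0 // ler_peMr ?exprn_ge0 // ler1n.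
exact: fact_gt0.
Qed.

Lemma cos_termS_le k x : 0 <= x <= pi -> `|cos_term k.+1 x| <= x ^+ 2 * pi ^+ (2 * k).
Proof.
move=> xpi; rewrite /cos_term -mulrA normrM normrX normrN normr1 expr1n mul1r.
apply: le_trans (norm_power_term_le _ xpi) _.
have /andP[x0 xp] := xpi.
by rewrite mulnS exprD ler_wpM2l ?sqr_ge0 // lerXn2r // nnegrE ?pi_ge0.
Qed.

Lemma sin_term_le k x : 0 <= x <= pi -> `|sin_term k x| <= x * pi ^+ (2 * k).
Proof.
move=> xpi; rewrite /sin_term -mulrA normrM normrX normrN normr1 expr1n mul1r.
apply: le_trans (norm_power_term_le _ xpi) _.
have /andP[x0 xp] := xpi.
by rewrite exprS ler_wpM2l // lerXn2r // nnegrE ?pi_ge0.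
Qed.

Lemma dirichlet_primitive0 N k : dirichlet_primitive N k 0 = 0.
Proof.
rewrite /dirichlet_primitive big1 ?addr0 => [|i _]; last exact: cos_primitive0.
by rewrite /sin_term expr0n /= mulr0 mul0r mulr0.
Qed.

(** The kernel is sin(Mx)/(2 sin(x/2)), and [cos_term k.+1] vanishes to order at least two at 0, so
    its quotient [q] by sin(x/2) has a bounded derivative. One integration by parts then gains a
    factor 1/M. *)
Lemma dirichlet_primitive_le N k :
  `|dirichlet_primitive N k.+1 pi| <= 7 * pi ^+ (2 * k.+1) / (N%:R + 2^-1).
Proof.
set M : R := N%:R + 2^-1; set c : R := pi ^+ (2 * k).
have N0 : 0 <= N%:R :> R by [].
have M0 : 0 < M by rewrite /M; lra.
have M1 : 2^-1 <= M by rewrite /M; lra.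
have c0 : 0 <= c by rewrite exprn_ge0 // pi_ge0.
have pi2 := @pi_ge2 R; have pi0 := @pi_ge0 R.
have pi4 : pi <= 4 :> R by have := pihalf_lt2 R; lra.
have sge x : 0 <= x <= pi -> x / 6 <= sin (2^-1 * x).
  move=> /andP[x0 xp]; have : 0 <= 2^-1 * x <= 2 by apply/andP; split; lra.
  by move=> /sin_ge_third; lra.
have ViM : 0 <= M^-1 by rewrite invr_ge0 ltW.
have hM0 : 0 <= 2^-1 * M^-1 by rewrite mulr_ge0.
have ViM2 : M^-1 <= 2 by rewrite -[leRHS]invrK lef_pV2 ?posrE ?invr_gt0.
pose q u : R := cos_term k.+1 u * (sin (2^-1 * u))^-1.
pose dq u : R := - sin_term k u * (sin (2^-1 * u))^-1
  + cos_term k.+1 u * (- (sin (2^-1 * u)) ^- 2 * (2^-1 * cos (2^-1 * u))).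
have s0 u : 0 < u <= pi -> 0 < sin (2^-1 * u).
  move=> /andP[u0 up]; apply: lt_le_trans (sge _ _); last by rewrite ltW.
  by rewrite divr_gt0.
have hq u : 0 < u <= pi -> is_derive u 1 q (dq u).
  move=> /s0 su; apply: is_derive_mul; first exact: is_derive_cos_termS.
  have sn : sin (2^-1 * u) != 0 by rewrite gt_eqF.
  exact: (@is_deriveV _ (fun u => sin (2^-1 * u)) u _ 1 sn (is_derive_sin_scaled 2^-1 u)).
(* The boundary term of the integration by parts; [F] is what remains, and its derivative carries
   the factor 1/M. *)
pose rem u : R := - (2^-1 * M^-1) * (q u * cos (M * u)).
pose F u : R := dirichlet_primitive N k.+1 u + -1 * rem u.
have hF u : 0 < u <= pi -> is_derive u 1 F (2^-1 * M^-1 * (dq u * cos (M * u))).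
  move=> upi; have su := s0 _ upi.
  have h1 := is_derive_dirichlet_primitive N k.+1 u.
  have h2 := is_derive_mul (hq _ upi) (is_derive_cos_scaled M u).
  apply: is_derive_eq (is_derive_add h1 (is_derive_scale _ (is_derive_scale _ h2))) _.
  have -> : 2^-1 + \sum_(n < N) cos (n.+1%:R * u) = sin (M * u) / (2 * sin (2^-1 * u)).
    by rewrite -dirichlet_kernel; field; rewrite gt_eqF.
  by rewrite /q; field; rewrite !gt_eqF.
have sV u : 0 < u <= pi -> 0 <= (sin (2^-1 * u))^-1 <= 6 / u.
  move=> upi; have su := s0 _ upi; have /andP[u0 up] := upi.
  rewrite invr_ge0 ltW //= -[leRHS]invf_div lef_pV2 ?posrE ?divr_gt0 //.
  by apply: sge; rewrite ltW.
(* With 1/sin(u/2) <= 6/u the two summands of [dq] give 6 c and 36 c / 2. *)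
have dqB u : 0 < u <= pi -> `|dq u| <= 24 * c.
  move=> upi; have /andP[u0 up] := upi; have /andP[v0 v6] := sV _ upi.
  have u01 : 0 <= u <= pi by rewrite ltW.
  have t1 : `|- sin_term k u * (sin (2^-1 * u))^-1| <= (u * c) * (6 / u).
    by rewrite normrM normrN (ger0_norm v0) ler_pM // sin_term_le.
  have t2 : `|cos_term k.+1 u * (- (sin (2^-1 * u)) ^- 2 * (2^-1 * cos (2^-1 * u)))|
      <= (u ^+ 2 * c) * ((6 / u) ^+ 2 * 2^-1).
    rewrite normrM ler_pM ?cos_termS_le // normrM normrN -exprVn normrX (ger0_norm v0).
    have u6 : 0 <= 6 / u by exact: le_trans v6.
    apply: ler_pM; rewrite ?exprn_ge0 ?lerXn2r ?nnegrE //.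
    rewrite normrM ger0_norm // -[leRHS]mulr1 ler_wpM2l // ler_norml.
    by rewrite cos_geN1 cos_le1.
  apply: le_trans (ler_normD _ _) _; apply: le_trans (lerD t1 t2) _.
  rewrite [leLHS](_ : _ = 24 * c) //; field; by rewrite gt_eqF.
have cos1 x : `|cos x| <= 1 :> R by rewrite ler_norml cos_geN1 cos_le1.
have remB u : 0 < u <= pi -> `|rem u| <= 6 * c * u.
  move=> upi; have /andP[u0 up] := upi; have /andP[v0 v6] := sV _ upi.
  have u01 : 0 <= u <= pi by rewrite ltW.
  rewrite /rem normrM normrN (ger0_norm hM0) normrM.
  have t : `|q u| <= (u ^+ 2 * c) * (6 / u).
    by rewrite /q normrM (ger0_norm v0) ler_pM // cos_termS_le.
  rewrite [leRHS](_ : _ = 1 * ((u ^+ 2 * c) * (6 / u) * 1)); last by field; rewrite gt_eqF.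
  by rewrite ler_pM ?mulr_ge0 // ?ler_pM //; lra.
have rempi : `|rem pi| <= 2^-1 * M^-1 * (pi ^+ 2 * c).
  rewrite /rem normrM normrN (ger0_norm hM0) ler_wpM2l // normrM.
  rewrite -[leRHS]mulr1 ler_pM // /q (mulrC 2^-1) sin_pihalf invr1 mulr1.
  by rewrite cos_termS_le // pi_ge0 lexx.
have Fpi : `|F pi| <= 12 * c * M^-1 * pi.
  apply/ler_addgt0Pr => e e0.
  (* The derivative of [F] is known only on ]0, pi], so the mean value bound is applied on [dl, pi].
     At dl both parts of [F] are O(dl): [E] adds their two constants, plus 1 to be positive. *)
  pose E := (pi ^+ 2 * c * (N%:R + 1) + 6 * c + 1).
  have a0 : 0 <= pi ^+ 2 * c * (N%:R + 1).
    by apply: mulr_ge0; [apply: mulr_ge0 => //; exact: sqr_ge0|apply: addr_ge0].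
  have E0 : 0 < E by rewrite /E; lra.
  pose dl := Num.min pi (e / E).
  have dl0 : 0 < dl by rewrite lt_min pi_gt0 divr_gt0.
  have dlpi : dl <= pi by rewrite ge_min lexx.
  have dlE : dl * E <= e by rewrite -ler_pdivlMr // ge_min lexx orbT.
  have A1 : `|F pi - F dl| <= 12 * c * M^-1 * (pi - dl).
    apply: (mean_value_le dlpi) => u /andP[u0 up].
      by apply: hF; rewrite up (lt_le_trans dl0 u0).
    have upi : 0 < u <= pi by rewrite up (lt_le_trans dl0 u0).
    rewrite normrM (ger0_norm hM0) normrM.
    rewrite [leRHS](_ : _ = 2^-1 * M^-1 * (24 * c * 1)); last by field; rewrite gt_eqF.
    by rewrite ler_wpM2l ?mulr_ge0 // ler_pM // dqB.
  have A2 : `|dirichlet_primitive N k.+1 dl| <= pi ^+ 2 * c * (N%:R + 1) * dl.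
    rewrite -[X in `|X|]subr0 -(dirichlet_primitive0 N k.+1) -[X in _ * X]subr0.
    apply: (mean_value_le (ltW dl0)) => u /andP[u0 up].
      exact: is_derive_dirichlet_primitive.
    have u01 : 0 <= u <= pi by rewrite u0 (le_trans up).
    rewrite normrM ler_pM //.
      apply: le_trans (cos_termS_le _ u01) _; rewrite ler_wpM2r // lerXn2r ?nnegrE //.
      by case/andP: u01.
    apply: le_trans (ler_normD _ _) _; rewrite addrC lerD //; last by rewrite ger0_norm //; lra.
    apply: le_trans (ler_norm_sum _ _ _) _.
    apply: le_trans (ler_sum _ (fun (i : 'I_N) _ => cos1 (i.+1%:R * u))) _.
    by rewrite sumr_const card_ord.
  have A3 : `|rem dl| <= 6 * c * dl by apply: remB; rewrite dl0.
  have -> : F pi = (F pi - F dl) + dirichlet_primitive N k.+1 dl + -1 * rem dl.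
    by rewrite /F; ring.
  apply: le_trans (ler_normD _ _) _; rewrite mulN1r normrN.
  apply: le_trans (lerD (ler_normD _ _) A3) _.
  apply: le_trans (lerD (lerD A1 A2) (lexx _)) _.
  have : 12 * c * M^-1 * (pi - dl) <= 12 * c * M^-1 * pi.
    by rewrite ler_wpM2l ?mulr_ge0 // gerBl ltW.
  move: dlE; rewrite /E.
  set a1 := 12 * c * M^-1 * (pi - dl); set a2 := 12 * c * M^-1 * pi.
  by move=> h1 h2; have := ltW dl0; lra.
have -> : dirichlet_primitive N k.+1 pi = F pi + rem pi by rewrite /F; ring.
apply: le_trans (ler_normD _ _) _; apply: le_trans (lerD Fpi rempi) _.
have -> : pi ^+ (2 * k.+1) = pi ^+ 2 * c :> R by rewrite mulnS exprD.
(* This turns 12 pi into at most 6 pi^2; with the 1/2 of the boundary term, 7 suffices. *)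
have h1 : pi * 2 <= pi ^+ 2 :> R by rewrite expr2 ler_wpM2l.
have cM : 0 <= c * M^-1 by rewrite mulr_ge0.
have := ler_wpM2l cM h1.
rewrite (_ : 12 * c * M^-1 * pi = 6 * (c * M^-1 * (pi * 2))); last by ring.
rewrite (_ : 2^-1 * M^-1 * (pi ^+ 2 * c) = 2^-1 * (c * M^-1 * pi ^+ 2)); last by ring.
rewrite (_ : 7 * (pi ^+ 2 * c) / M = 7 * (c * M^-1 * pi ^+ 2)); last by ring.
have : 0 <= c * M^-1 * pi ^+ 2 by rewrite mulr_ge0 // exprn_ge0.
by move: (c * M^-1 * pi ^+ 2) (c * M^-1 * (pi * 2)) => *; lra.
Qed.

Lemma zetabar_cvg s : (0 < s)%N ->
  (\sum_(n < N) (-1) ^+ n / n.+1%:R ^+ s : R) @[N --> \oo] --> zb s.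
Proof.
case: s => // s _.
pose u n : R := (n.+1%:R ^+ s.+1)^-1.
have ud n : u n.+1 <= u n.
  by rewrite lef_pV2 ?posrE ?exprn_gt0 ?ltr0n // lerXn2r ?nnegrE ?ler0n // ler_nat.
have u0 n : 0 <= u n by rewrite invr_ge0 exprn_ge0 ?ler0n.
have : cvgn (fun N => \sum_(n < N) (-1) ^+ n * u n).
  apply: (@alternating_cvg _ _ (fun n => u n - u n.+1) (u 0%N)).
  - by move=> n; rewrite distrC ger0_norm // subr_ge0.
  - move=> N; suff -> : \sum_(n < N) (u n - u n.+1) = u 0%N - u N by rewrite gerBl.
    by elim: N => [|N IH]; rewrite ?big_ord0 ?subrr // big_ord_recr /= IH; ring.
  - apply: (@squeeze_cvgr _ _ _ _ (fun=> 0) harmonic); last exact: cvg_harmonic.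
      near=> n; rewrite u0 /= lef_pV2 ?posrE ?exprn_gt0 ?ltr0n //.
      by rewrite exprS ler_peMr ?ler0n // exprn_ege1 // ler1n.
    exact: cvg_cst.
move=> c; rewrite /zetabar.
rewrite (_ : (fun N => \sum_(1 <= n < N.+1) _) = fun N => \sum_(n < N) (-1) ^+ n * u n) //.
apply: funext => N; rewrite big_add1 big_mkord; apply: eq_bigr => n _.
by [].
Unshelve. all: by end_near. Qed.

(** In positive degree, the identity between pi x/sin(pi x), with coefficients 2 zb(2i), and its
    inverse. Up to the factor pi the sum is the limit of [dirichlet_primitive] at pi, and that limit
    is 0 because x^(2d+2) kills the mass which the kernel concentrates at 0. *)
Lemma zetabar_sinc d : \sum_(i < d.+2) zb (2 * i) * sinc_fps R (d.+1 - i)%N = 0.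
Proof.
have sE k : sin_term k pi = pi * sinc_fps R k.
  by rewrite /sin_term /sinc_fps exprS; ring.
have c1 : dirichlet_primitive N d.+1 pi @[N --> \oo] -->
    pi * \sum_(i < d.+2) zb (2 * i) * sinc_fps R (d.+1 - i)%N.
  rewrite big_ord_recl subn0 mulrDr mulr_sumr.
  apply: cvgD.
    rewrite (_ : pi * _ = 2^-1 * sin_term d.+1 pi); first exact: cvg_cst.
    by rewrite sE mulrCA.
  rewrite (_ : (fun N => _) = fun N => \sum_(i <- enum 'I_d.+1)
      sin_term (d - i) pi * \sum_(n < N) (-1) ^+ n / n.+1%:R ^+ (2 * i.+1)).
    rewrite -big_enum; apply: cvg_sum_seq => i _.
    have hz := @zetabar_cvg (2 * i.+1) isT.
    rewrite lift0 subSS (mulrC (zb _)) mulrA -sE.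
    exact: (@cvgMl_tmp _ _ _ _ _ (sin_term (d - i) pi) _ hz).
  apply: funext => N; rewrite big_enum /=.
  rewrite (eq_bigr _ (fun (n : 'I_N) _ => cos_primitive_pi n d.+1)) exchange_big; apply: eq_bigr => i _; rewrite mulr_sumr.
  by apply: eq_bigr => n _; rewrite subSS mulrC.
pose K : R := 7 * pi ^+ (2 * d.+1).
have bK N : `|dirichlet_primitive N d.+1 pi| <= K * (2 * harmonic N).
  apply: le_trans (dirichlet_primitive_le N d) _.
  rewrite -/K ler_wpM2l ?mulr_ge0 ?exprn_ge0 ?pi_ge0 // /harmonic /=.
  have N0 : 0 <= N%:R :> R by [].
  have M0 : 0 < N%:R + 2^-1 :> R by lra.
  by rewrite -(ler_pM2l M0) mulfV ?gt_eqF // mulrA ler_pdivlMr ?ltr0n // -natr1; lra.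
have c2 : dirichlet_primitive N d.+1 pi @[N --> \oo] --> 0.
  apply: norm_cvg0; apply: (@squeeze_cvgr _ _ _ _ (fun=> 0) (fun N => K * (2 * harmonic N))).
  - by near=> N; rewrite normr_ge0 bK.
  - exact: cvg_cst.
  - rewrite -[X in _ --> X](mulr0 K); apply: cvgMl_tmp.
    by rewrite -[X in _ --> X](mulr0 2); apply: cvgMl_tmp; exact: cvg_harmonic.
have /eqP : pi * \sum_(i < d.+2) zb (2 * i) * sinc_fps R (d.+1 - i)%N = 0.
  by rewrite -(cvg_lim _ c1) // (cvg_lim _ c2).
by rewrite mulf_eq0 gt_eqF ?pi_gt0 // => /eqP.
Unshelve. all: by end_near. Qed.

End Euler.

(** * The numbers Z(j,p) *)

Section ZRecursion.
Variable R : realType.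
Local Notation zb := (zetabar R).

Fixpoint zchains (k j p : nat) : seq (seq nat) :=
  if k is k'.+1 then [seq i :: s | i <- iota j.+1 (p - j), s <- zchains k' i p]
  else if j == p then [:: [::]] else [::].

Lemma zchains_uniq k j p : uniq (zchains k j p).
Proof.
elim: k j => [|k IH] j /=; first by case: ifP.
by apply: uniq_cons_dep => //; exact: iota_uniq.
Qed.

Lemma mem_zchains k j p s : (s \in zchains k j p) =
  [&& size s == k, all (fun x => (x < p.+1)%N) s &
      sorted ltn (j :: s) && (last j s == p)].
Proof.
elim: k j s => [|k IH] j s /=.
  by case: s => [|x s] /=; case: ifP => // _; rewrite ?inE // in_nil.
apply/allpairsPdep/and3P => [[i [s' [ii]]]|].
  rewrite IH => /and3P[/eqP ss sm /andP[ps ls]] ->.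
  rewrite mem_iota in ii; move: ps => /= ps; rewrite /= ss sm ls ps; split=> //; lia.
case: s => [[]//|i s] /= [ss /andP[ip sp] /andP[/andP[ji ps] ls]].
by exists i, s; split=> //; [rewrite mem_iota; lia|rewrite IH -eqSS ss sp /= ps ls].
Qed.

(** The part of Z(j,p) from chains with k steps, the factor (-2)^k being spread over the steps. *)
Definition zsum (k j p : nat) : R := \sum_(s <- zchains k j p)
  \prod_(l < k) (-2 * zb (2 * nth 0%N (j :: s) l.+1 - 2 * nth 0%N (j :: s) l)%N).

Lemma zsumS k j p : zsum k.+1 j p =
  \sum_(i < p - j) (-2 * zb (2 * i.+1)) * zsum k (j + i.+1) p.
Proof.
rewrite /zsum [LHS]big_allpairs_dep /= -(addn0 j.+1) iotaDl big_map.
rewrite -[X in iota 0 X]subn0 big_mkord; apply: eq_bigr => i _.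
rewrite mulr_sumr addSnnS; apply: eq_bigr => s _; rewrite big_ord_recl /=.
by rewrite mulnDr addnC addnK.
Qed.

Lemma zsum_small k j p : (p - j < k)%N -> zsum k j p = 0.
Proof.
elim: k j => // k IH j jk; rewrite zsumS big1 // => i _.
by rewrite IH ?mulr0 //; have := ltn_ord i; lia.
Qed.

Lemma zsum0 j p : zsum 0 j p = (j == p)%:R.
Proof. by rewrite /zsum /=; case: eqP; rewrite ?big_seq1 ?big_ord0 ?big_nil. Qed.

(** Chains with more than p - j steps do not exist, so any larger M gives the same sum; the
    recursion needs one M for all starting points. The empty chain supplies the value 1 at j = p. *)
Lemma Z_zsum (j p M : nat) : (j <= p)%N -> (p - j < M)%N -> Z R j p = \sum_(k < M) zsum k j p.
Proof.
move=> jp jM; case: M jM => // M jM; rewrite big_ord_recl zsum0 /Z.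
have [->|njp] := eqVneq j p.
  by rewrite big1 ?addr0 // => i _; rewrite zsum_small // subnn.
rewrite add0r big_add1 big_mkord.
have -> : M = (p - j + (M - (p - j)))%N by lia.
rewrite [RHS]big_split_ord [X in _ = _ + X]big1 ?addr0; last first.
  by move=> i _; rewrite zsum_small // /= /bump /=; lia.
apply: eq_bigr => k _; rewrite (@sum_tuple_seq _ _ _
  (fun s => sorted ltn (j :: s) && (last j s == p)) (zchains k.+1 j p)
  (fun s => \prod_(l < k.+1) zb (2 * nth 0%N (j :: s) l.+1 - 2 * nth 0%N (j :: s) l)%N)
  (zchains_uniq _ _ _)); last by move=> s; rewrite mem_zchains.
rewrite mulr_sumr; apply: eq_bigr => s _.
by rewrite big_split /= prodr_const card_ord.
Qed.

(** Splitting off the first step of a chain gives the recursion for the inverse of the series with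
    coefficients 2 zb(2i). By [zetabar_sinc] the sinc coefficients satisfy it too, zb(0) = 1/2
    isolating the leading one. *)
Lemma Z_sinc (j p : nat) : (j <= p)%N -> Z R j p = sinc_fps R (p - j)%N.
Proof.
move=> jp; move e : (p - j)%N => d; elim/ltn_ind: d j jp e => d IH j jp e.
rewrite (@Z_zsum j p (p - j).+1) // big_ord_recl.
case: d IH e => [|d] IH e.
  have -> : j = p by lia.
  rewrite subnn big_ord0 addr0 zsum0 eqxx.
  by rewrite /sinc_fps muln0 !expr0 divr1 mulr1.
have -> : zsum 0 j p = 0.
  by rewrite zsum0; case: eqP => // jp'; move: e; rewrite jp' subnn.
rewrite add0r; under eq_bigr do rewrite lift0 zsumS.
rewrite exchange_big /= e.
transitivity (\sum_(i < d.+1) (-2 * zb (2 * i.+1)) * sinc_fps R (d - i)%N).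
  apply: eq_bigr => i _; rewrite -mulr_sumr; congr (_ * _); have := ltn_ord i => ip.
  by rewrite -(@IH (d - i)%N _ (j + i.+1)%N) ?(@Z_zsum (j + i.+1) p d.+1) //; lia.
have := zetabar_sinc R d; rewrite big_ord_recl subn0 /= => /eqP; rewrite addr_eq0 => /eqP h.
transitivity (-2 * \sum_(i < d.+1) zb (2 * i.+1) * sinc_fps R (d - i)%N).
  by rewrite mulr_sumr; apply: eq_bigr => i _; rewrite -mulrA.
have -> : \sum_(i < d.+1) zb (2 * i.+1) * sinc_fps R (d - i)%N = - (2^-1 * sinc_fps R d.+1).
  by rewrite h opprK; apply: eq_bigr => i _; rewrite /bump /= add1n subSS.
by field.
Qed.

End ZRecursion.

Unset Implicit Arguments.

Theorem theorem1p2 (R : realType) (m p : nat) (hm : (0 < m)%N) (hp : (0 < p)%N) :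
  (-1) ^+ m * \sum_(1 <= j < p.+1) W R (2 * j + 2 * m - 3) (2 * m - 1) * Z R j p
  = (-1) ^+ p * \sum_(1 <= j < m.+1) W R (2 * j + 2 * p - 3) (2 * p - 1) * Z R j m.
Proof.
(* With p = a + 1, m = b + 1 and i = p - j, either side of the theorem becomes a Cauchy product
   coefficient, and its sign (-1)^m is the one built into [odd_depth]. *)
have side (a b : nat) :
    (-1) ^+ b.+1 * \sum_(1 <= j < a.+2) W R (2 * j + 2 * b.+1 - 3) (2 * b.+1 - 1) * Z R j a.+1
    = \sum_(i < a.+1) sinc_fps R i * odd_depth R (a - i) b.
  rewrite big_add1 big_mkord (reindex_inj rev_ord_inj) mulr_sumr.
  apply: eq_bigr => i _; have ia := ltn_ord i; rewrite /= subSS.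
  rewrite Z_sinc; last by lia.
  rewrite /odd_depth /weight_lim mulrA mulrC.
  have -> : (a.+1 - (a - i).+1 = i)%N by lia.
  have -> : (2 * (a - i).+1 + 2 * b.+1 - 3 = 2 * (a - i) + (2 * b).+1)%N by lia.
  by have -> : (2 * b.+1 - 1 = (2 * b).+1)%N by lia.
case: m hm => // b _; case: p hp => // a _.
by rewrite !side odd_depth_symmetry.
Qed.
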